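(* A function of the form $$A_0(\underline{y})+\sum_{k=1}^\infty\left(z^kA_k(\underline{y})+\overline{z}^kB_k(\underline{y})\right),$$ is two-sided monogenic if and only if the functions $A_k$ are harmonic satisfying the system \begin{equation*} \left\{\begin{array}{rl} A_0\partial_{\underline{y}}+A_1+e_1A_1e_1-\frac{1}{2}\partial_{\underline{y}} A_0+\frac{1}{2}e_1\partial_{\underline{y}} A_0e_1=0,\\ A_k\partial_{\underline{y}}+(k+1)A_{k+1}+(k+1)e_1A_{k+1}e_1=0,\quad k\geq 1, \end{array}\right. \end{equation*} and $B_k=-\frac{1}{2k}\partial_{\underline{y}} A_{k-1}$, $k\geq 1$. In particular, if $M_k(\underline{y})$, $k\geq 0$, are right monogenic functions, then $$M_0(\underline{y})+\sum_{k=1}^\infty\left(z^k(M_k(\underline{y})-e_1M_k(\underline{y})e_1)-\frac{1}{2k}\overline{z}^k(\partial_{\underline{y}} M_{k-1}(\underline{y})+e_1\partial_{\underline{y}} M_{k-1}(\underline{y})e_1)\right)$$ is two-sided monogenic.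
   Context: Let $\mathbb{R}_{0,m}$ be the real Clifford algebra generated by $e_1,\dots,e_m$ with $e_i^2=-1$, $e_ie_j=-e_je_i$ ($i\neq j$). A point of $\mathbb{R}^{m+1}$ is identified with the paravector $X=x_0+\sum_{j=1}^m x_je_j$, split as $X=z+\underline{y}$ with $z=x_0+x_1e_1$, $\overline{z}=x_0-x_1e_1$ and $\underline{y}=\sum_{j=2}^m x_je_j$. The generalized Cauchy-Riemann operator is $\partial_X=\partial_{x_0}+\sum_{j=1}^m e_j\partial_{x_j}$, and $\partial_{\underline{y}}=\sum_{j=2}^m e_j\partial_{x_j}$ is the Dirac operator in the variable $\underline{y}$; for an $\mathbb{R}_{0,m}$-valued $f$, $\partial_{\underline{y}}f=\sum_{j=2}^m e_j\partial_{x_j}f$ (left action) and $f\partial_{\underline{y}}=\sum_{j=2}^m (\partial_{x_j}f)e_j$ (right action). A function $f$ is left monogenic if $\partial_Xf=0$, right monogenic if $f\partial_X=0$ (similarly with $\partial_{\underline{y}}$ for functions of $\underline{y}$), and two-sided monogenic if both hold. Here $A_0$, $A_k$, $B_k$ ($k\geq1$) are $\mathbb{R}_{0,m}$-valued functions depending only on $\underline{y}$, harmonic means annihilated by the Laplacian in $\underline{y}$, and all required differentiations and convergences of the series are tacitly assumed well defined.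
   Formalization: In the ''in particular'' part the leading term M_0 is replaced by M_0 - e_1 M_0 e_1, since the printed formula fails, e.g. for M_0 = x_2 - x_3 e_3 e_2 and M_k = 0 (k ≥ 1); the tacit regularity is taken as smooth coefficients and termwise differentiation on {|z|<r} × U. *)

(* Defs.v *)
From HB Require Import structures.
From mathcomp Require Import all_boot all_order all_algebra.
From mathcomp Require Import all_classical all_reals all_analysis.

Set Implicit Arguments.
Unset Strict Implicit.
Unset Printing Implicit Defensive.

Import Order.TTheory GRing.Theory Num.Theory.
Import numFieldNormedType.Exports.
Local Open Scope ring_scope.
Local Open Scope classical_set_scope.

Section Clifford.
Variable R : realType.

(* The real Clifford algebra R_{0,N} with generators indexed by 'I_N:  *)
(* an element is a real coefficient for every blade e_A, A ⊆ 'I_N      *)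
(* (e_A = e_{a1} ... e_{ak} with a1 < ... < ak).                       *)
Definition Cl (N : nat) := {ffun {set 'I_N} -> R}.

(* sign of e_A e_B = sgn A B * e_{A Δ B}, for e_i^2 = -1 and
   e_i e_j = - e_j e_i (i != j) *)
Definition clsgn N (A B : {set 'I_N}) : R :=
  (-1) ^+ (#|finset.finset (fun p : 'I_N * 'I_N => [&& p.1 \in A, p.2 \in B & (p.2 < p.1)%N])|
           + #|A :&: B|).

Definition clmul N (x y : Cl N) : Cl N :=
  [ffun C => \sum_(A : {set 'I_N}) \sum_(B : {set 'I_N} | (A :\: B) :|: (B :\: A) == C)
               clsgn A B * x A * y B].

Definition clscale N (c : R) (x : Cl N) : Cl N := [ffun S => c * x S].

Definition clone N : Cl N := [ffun S => (S == finset.set0)%:R].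

Definition gen N (i : 'I_N) : Cl N := [ffun S => (S == finset.set1 i)%:R].

Definition clpow N (x : Cl N) (k : nat) : Cl N := iter k (clmul x) (clone N).

(* Setting of the paper with m = n.+1 generators: the generator with   *)
(* index ord0 is e_1, the generator with index lift ord0 j (j : 'I_n)  *)
(* is e_{j+2}.  The variable y = (x_2,...,x_m) lives in 'rV[R]_n.      *)
Definition e1 n : Cl n.+1 := gen (ord0 : 'I_n.+1).
Definition ey n (j : 'I_n) : Cl n.+1 := gen (lift ord0 j).

Definition zz n (x0 x1 : R) : Cl n.+1 := clscale x0 (clone _) + clscale x1 (e1 n).
Definition zzbar n (x0 x1 : R) : Cl n.+1 := clscale x0 (clone _) - clscale x1 (e1 n).

Definition ydir n (j : 'I_n) : 'rV[R]_n := delta_mx 0 j.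

Definition pdy n (j : 'I_n) (f : 'rV[R]_n -> Cl n.+1) : 'rV[R]_n -> Cl n.+1 :=
  fun y => [ffun S => 'D_(ydir j) (fun q => f q S) y].

Definition pdyable n (j : 'I_n) (f : 'rV[R]_n -> Cl n.+1) (y : 'rV[R]_n) : Prop :=
  forall S, derivable (fun q => f q S) y (ydir j).

Definition diracL n (f : 'rV[R]_n -> Cl n.+1) (y : 'rV[R]_n) : Cl n.+1 :=
  \sum_(j < n) clmul (ey j) (pdy j f y).
Definition diracR n (f : 'rV[R]_n -> Cl n.+1) (y : 'rV[R]_n) : Cl n.+1 :=
  \sum_(j < n) clmul (pdy j f y) (ey j).

Definition right_monogenic_y n (U : set 'rV[R]_n) (f : 'rV[R]_n -> Cl n.+1) : Prop :=
  forall y, U y -> (forall j, pdyable j f y) /\ diracR f y = 0.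

Definition laplacian n (f : 'rV[R]_n -> Cl n.+1) (y : 'rV[R]_n) : Cl n.+1 :=
  \sum_(j < n) pdy j (pdy j f) y.

Definition harmonic_on n (U : set 'rV[R]_n) (f : 'rV[R]_n -> Cl n.+1) : Prop :=
  forall y, U y ->
    (forall j, pdyable j f y /\ pdyable j (pdy j f) y) /\ laplacian f y = 0.

(* iterated partial derivatives and smoothness (all partial derivatives
   of all orders exist and are continuous on U) -- the tacit regularity *)
Definition itpd n (s : seq 'I_n) (f : 'rV[R]_n -> Cl n.+1) : 'rV[R]_n -> Cl n.+1 :=
  foldr (fun j g => pdy j g) f s.

Definition smooth_on n (U : set 'rV[R]_n) (f : 'rV[R]_n -> Cl n.+1) : Prop :=
  forall (s : seq 'I_n) y, U y ->
    (forall j, pdyable j (itpd s f) y) /\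
    (forall S, {for y, continuous (fun q => itpd s f q S)}).

(* --- functions of X = x0 + x1 e1 + y, written curried in (x0, x1, y) --- *)
Definition FunX n := R -> R -> 'rV[R]_n -> Cl n.+1.

Inductive dirX (n : nat) := Dx0 | Dx1 | Dy of 'I_n.

Definition pdX n (d : dirX n) (F : FunX n) (x0 x1 : R) (y : 'rV[R]_n) : Cl n.+1 :=
  [ffun S => match d with
             | Dx0 => derive1 (fun t => F t x1 y S) x0
             | Dx1 => derive1 (fun t => F x0 t y S) x1
             | Dy j => 'D_(ydir j) (fun q => F x0 x1 q S) y
             end].

Definition pdXable n (d : dirX n) (F : FunX n) (x0 x1 : R) (y : 'rV[R]_n) : Prop :=
  forall S, match d with
            | Dx0 => derivable (fun t => F t x1 y S) x0 1
            | Dx1 => derivable (fun t => F x0 t y S) x1 1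
            | Dy j => derivable (fun q => F x0 x1 q S) y (ydir j)
            end.

Definition cauchyL n (F : FunX n) x0 x1 y : Cl n.+1 :=
  pdX (Dx0 n) F x0 x1 y + clmul (e1 n) (pdX (Dx1 n) F x0 x1 y)
  + \sum_(j < n) clmul (ey j) (pdX (Dy j) F x0 x1 y).
Definition cauchyR n (F : FunX n) x0 x1 y : Cl n.+1 :=
  pdX (Dx0 n) F x0 x1 y + clmul (pdX (Dx1 n) F x0 x1 y) (e1 n)
  + \sum_(j < n) clmul (pdX (Dy j) F x0 x1 y) (ey j).

Definition left_monogenic n (Om : R -> R -> 'rV[R]_n -> Prop) (F : FunX n) : Prop :=
  forall x0 x1 y, Om x0 x1 y -> (forall d, pdXable d F x0 x1 y) /\ cauchyL F x0 x1 y = 0.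
Definition right_monogenic n (Om : R -> R -> 'rV[R]_n -> Prop) (F : FunX n) : Prop :=
  forall x0 x1 y, Om x0 x1 y -> (forall d, pdXable d F x0 x1 y) /\ cauchyR F x0 x1 y = 0.
Definition two_sided_monogenic n Om (F : FunX n) : Prop :=
  left_monogenic Om F /\ right_monogenic Om F.

Definition clsum_to N (u : nat -> Cl N) (l : Cl N) : Prop :=
  forall S, (fun M : nat => \sum_(k < M) u k S) @ \oo --> l S.

Definition term n (A B : nat -> 'rV[R]_n -> Cl n.+1) (k : nat) : FunX n :=
  fun x0 x1 y =>
    if k is 0 then A 0%N y
    else clmul (clpow (zz n x0 x1) k) (A k y) + clmul (clpow (zzbar n x0 x1) k) (B k y).

Definition Omega n (r : \bar R) (U : set 'rV[R]_n) : R -> R -> 'rV[R]_n -> Prop :=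
  fun x0 x1 y => ((Num.sqrt (x0 ^+ 2 + x1 ^+ 2))%:E < r)%E /\ U y.

(* the tacit assumptions: on Om the series of the terms T k converges to F,
   F has all first partial derivatives, and these are obtained by
   termwise differentiation (the differentiated series converge). *)
Definition series_ok n (Om : R -> R -> 'rV[R]_n -> Prop) (T : nat -> FunX n)
  (F : FunX n) : Prop :=
  forall x0 x1 y, Om x0 x1 y ->
    clsum_to (fun k => T k x0 x1 y) (F x0 x1 y) /\
    forall d : dirX n, pdXable d F x0 x1 y /\ (forall k, pdXable d (T k) x0 x1 y) /\
      clsum_to (fun k => pdX d (T k) x0 x1 y) (pdX d F x0 x1 y).

End Clifford.

(* Main.v *)
From Pilot Require Import Defs.
From HB Require Import structures.
From mathcomp Require Import all_boot all_order all_algebra.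
From mathcomp Require Import all_classical all_reals all_analysis.
From mathcomp Require Import ring lra.
Import Order.TTheory GRing.Theory Num.Theory.
Import numFieldNormedType.Exports.
Local Open Scope ring_scope.
Local Open Scope classical_set_scope.
Import Pilot.Defs.

(** Write [X = z + y].  On [z^k] the operator [d/dx0 + e1 d/dx1] vanishes and on
    [zbar^k] it gives [2k zbar^(k-1)], while the Dirac operator [d] in [y] anticommutes
    with [e1] and so exchanges [z^k] and [zbar^k].  Applying the two Cauchy-Riemann
    operators termwise and shifting the index by one therefore turns two-sided
    monogenicity into the vanishing, for all small [z], of two series of the form
    [sum_k (z^k P_k + zbar^k Q_k)].  Restricted to a ray such a series is a power series
    in the radius, so every homogeneous term vanishes; differentiating a term in [x1] at
    [z = 1] gives [P_k = Q_k], and [z = 1] itself gives [P_k + Q_k = 0].  Hence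
    [P_k = Q_k = 0] for [k >= 1], and [P_0 + Q_0 = 0].  The resulting relations on [A_k],
    [B_k] are equivalent to the stated system because [d^2] is minus the Laplacian (by
    Schwarz's theorem) and the left and right actions of [d] commute; the relation on
    [B_k d] follows by applying [d] on the left to the system.  For [A_k = M_k - e1 M_k e1]
    with [M_k d = 0], the system holds because [x |-> e1 x e1] is an involution that
    anticommutes with [d]: [A_k d = 0] and [A_k + e1 A_k e1 = 0]. *)

Local Notation "x ** y" := (clmul x y) (at level 40, left associativity).

Section CliffordAlgebra.
Set Implicit Arguments.
Unset Strict Implicit.
Variables (R : realType) (N : nat).
Implicit Types (A B C D : {set 'I_N}) (x y z : Cl R N) (c : R).

Definition symdiff A B : {set 'I_N} := (A :\: B) :|: (B :\: A).

Lemma in_symdiff A B i : (i \in symdiff A B) = (i \in A) (+) (i \in B).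
Proof. by rewrite !inE; case: (i \in A); case: (i \in B). Qed.

Lemma symdiffC A B : symdiff A B = symdiff B A.
Proof. by apply/setP=> i; rewrite !in_symdiff addbC. Qed.

Lemma symdiffA A B C : symdiff A (symdiff B C) = symdiff (symdiff A B) C.
Proof. by apply/setP=> i; rewrite !in_symdiff addbA. Qed.

Lemma symdiff0 A : symdiff finset.set0 A = A.
Proof. by apply/setP=> i; rewrite in_symdiff inE. Qed.

Lemma symdiffv A : symdiff A A = finset.set0.
Proof. by apply/setP=> i; rewrite in_symdiff inE addbb. Qed.

Lemma symdiffK A : involutive (symdiff A).
Proof. by move=> B; rewrite symdiffA symdiffv symdiff0. Qed.

Lemma symdiff_eq A B C : (symdiff A B == C) = (B == symdiff A C).
Proof. by apply/eqP/eqP=> [<-|->]; rewrite symdiffK. Qed.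

Lemma clsgnE A B : clsgn R A B =
  \prod_(p : 'I_N * 'I_N) (-1) ^+ [&& p.1 \in A, p.2 \in B & (p.2 <= p.1)%N].
Proof.
rewrite prodrXr /clsgn; congr (_ ^+ _).
have -> : #|A :&: B| =
    (\sum_(p : 'I_N * 'I_N) [&& p.1 \in A, p.2 \in B & p.2 == p.1])%N.
  rewrite -sum1_card big_mkcond -(pair_bigA _ (fun i j : 'I_N =>
    ([&& i \in A, j \in B & j == i] : nat))) /=.
  apply: eq_bigr => i _; rewrite (bigD1 i)//= big1 ?addn0.
    by rewrite !inE eqxx andbT; case: (_ && _).
  by move=> j /negPf->; rewrite !andbF.
rewrite -sum1_card big_mkcond -big_split /=; apply: eq_bigr => p _.
rewrite !inE -(inj_eq val_inj) /= [in RHS]leq_eqVlt.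
case: (p.1 \in A); case: (p.2 \in B) => //=.
by case: ltngtP.
Qed.

Lemma clsgnDl A B C : clsgn R (symdiff A B) C = clsgn R A C * clsgn R B C.
Proof.
rewrite !clsgnE -big_split /=; apply: eq_bigr => p _; rewrite in_symdiff -signr_addb.
by case: (p.1 \in A); case: (p.1 \in B) => //=; rewrite ?addbb ?addbF.
Qed.

Lemma clsgnDr A B C : clsgn R A (symdiff B C) = clsgn R A B * clsgn R A C.
Proof.
rewrite !clsgnE -big_split /=; apply: eq_bigr => p _; rewrite in_symdiff -signr_addb.
by case: (p.1 \in A) => //=; case: (p.2 \in B); case: (p.2 \in C) => //=;
  rewrite ?addbb ?addbF.
Qed.

Lemma clsgn0l A : clsgn R (finset.set0 : {set 'I_N}) A = 1.
Proof. by rewrite clsgnE big1// => p _; rewrite inE. Qed.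

Lemma clsgn0r A : clsgn R A finset.set0 = 1.
Proof. by rewrite clsgnE big1// => p _; rewrite inE andbF. Qed.

Lemma clsgn1 (i j : 'I_N) : clsgn R (finset.set1 i) (finset.set1 j) = (-1) ^+ (j <= i)%N.
Proof.
rewrite clsgnE (bigD1 (i, j))//= !inE !eqxx /= big1 ?mulr1//.
by case=> a b /=; rewrite xpair_eqE !inE; do 2 case: eqP.
Qed.

Lemma clmulE x y C :
  (x ** y) C = \sum_A clsgn R A (symdiff A C) * x A * y (symdiff A C).
Proof.
rewrite ffunE; apply: eq_bigr => A _.
by rewrite (big_pred1 (symdiff A C))// => B; rewrite /= -symdiff_eq.
Qed.

Lemma clmulA x y z : x ** (y ** z) = x ** y ** z.
Proof.
apply/ffunP=> D; rewrite !clmulE.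
transitivity (\sum_A \sum_B clsgn R A (symdiff A D) * x A *
    (clsgn R B (symdiff B (symdiff A D)) * y B * z (symdiff B (symdiff A D)))).
  by apply: eq_bigr => A _; rewrite clmulE big_distrr.
transitivity (\sum_C \sum_A clsgn R C (symdiff C D) *
    (clsgn R A (symdiff A C) * x A * y (symdiff A C)) * z (symdiff C D)); last first.
  by apply: eq_bigr => C _; rewrite clmulE big_distrr big_distrl.
rewrite [RHS]exchange_big /=; apply: eq_bigr => A _.
rewrite [RHS](reindex_inj (inv_inj (symdiffK A))) /=; apply: eq_bigr => B _.
rewrite symdiffK clsgnDl -(symdiffA A B D) (symdiffA B A D) (symdiffC B A) -symdiffA.
have -> : symdiff A D = symdiff B (symdiff A (symdiff B D)).
  by rewrite (symdiffA A) (symdiffC A B) -(symdiffA B A D) symdiffK.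
by rewrite clsgnDr; ring.
Qed.

Lemma clmul1l x : clone R N ** x = x.
Proof.
apply/ffunP=> C; rewrite clmulE (bigD1 finset.set0)//= big1 ?addr0.
  by rewrite ffunE eqxx symdiff0 clsgn0l !mul1r.
by move=> A /negPf A0; rewrite ffunE A0 mulr0 mul0r.
Qed.

Lemma clmul1r x : x ** clone R N = x.
Proof.
apply/ffunP=> C; rewrite clmulE (bigD1 C)//= big1 ?addr0.
  by rewrite ffunE symdiffv eqxx clsgn0r mulr1 mul1r.
move=> A /negPf AC; rewrite ffunE symdiff_eq (symdiffC A finset.set0) symdiff0.
by rewrite eq_sym AC mulr0.
Qed.

Lemma clmulDl x y z : (x + y) ** z = x ** z + y ** z.
Proof.
apply/ffunP=> C; rewrite [RHS]ffunE !clmulE -big_split /=.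
by apply: eq_bigr => A _; rewrite ffunE; ring.
Qed.

Lemma clmulDr x y z : x ** (y + z) = x ** y + x ** z.
Proof.
apply/ffunP=> C; rewrite [RHS]ffunE !clmulE -big_split /=.
by apply: eq_bigr => A _; rewrite ffunE; ring.
Qed.

Lemma clmulZl c x y : clscale c x ** y = clscale c (x ** y).
Proof.
apply/ffunP=> C; rewrite [RHS]ffunE !clmulE big_distrr /=.
by apply: eq_bigr => A _; rewrite ffunE; ring.
Qed.

Lemma clmulZr c x y : x ** clscale c y = clscale c (x ** y).
Proof.
apply/ffunP=> C; rewrite [RHS]ffunE !clmulE big_distrr /=.
by apply: eq_bigr => A _; rewrite ffunE; ring.
Qed.

Lemma clscaleN1 x : clscale (-1) x = - x.
Proof. by apply/ffunP=> C; rewrite !ffunE mulN1r. Qed.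

Lemma clscale1 x : clscale 1 x = x.
Proof. by apply/ffunP=> C; rewrite !ffunE mul1r. Qed.

Lemma clscale0 x : clscale 0 x = 0.
Proof. by apply/ffunP=> C; rewrite !ffunE mul0r. Qed.

Lemma clscaler0 c : clscale c (0 : Cl R N) = 0.
Proof. by apply/ffunP=> C; rewrite !ffunE mulr0. Qed.

Lemma clscaleA c d x : clscale c (clscale d x) = clscale (c * d) x.
Proof. by apply/ffunP=> C; rewrite !ffunE mulrA. Qed.

Lemma clscaleDr c x y : clscale c (x + y) = clscale c x + clscale c y.
Proof. by apply/ffunP=> C; rewrite !ffunE mulrDr. Qed.

Lemma clmulNl x y : - x ** y = - (x ** y).
Proof. by rewrite -clscaleN1 clmulZl clscaleN1. Qed.

Lemma clmulNr x y : x ** - y = - (x ** y).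
Proof. by rewrite -clscaleN1 clmulZr clscaleN1. Qed.

Lemma clmul0l x : 0 ** x = 0.
Proof. by have := clmulZl 0 0 x; rewrite !clscale0. Qed.

Lemma clmul0r x : x ** 0 = 0.
Proof. by have := clmulZr 0 x 0; rewrite !clscale0. Qed.

Lemma clmul_suml (I : Type) (s : seq I) (P : pred I) (F : I -> Cl R N) y :
  (\sum_(i <- s | P i) F i) ** y = \sum_(i <- s | P i) F i ** y.
Proof. exact: (big_morph (fun x => x ** y) (fun u v => clmulDl u v y) (clmul0l y)). Qed.

Lemma clmul_sumr (I : Type) (s : seq I) (P : pred I) (F : I -> Cl R N) y :
  y ** (\sum_(i <- s | P i) F i) = \sum_(i <- s | P i) y ** F i.
Proof. exact: (big_morph (clmul y) (clmulDr y) (clmul0r y)). Qed.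

Lemma gen_mulE (i j : 'I_N) C : (gen R i ** gen R j) C =
  (-1) ^+ (j <= i)%N * (C == symdiff (finset.set1 i) (finset.set1 j))%:R.
Proof.
rewrite clmulE (bigD1 (finset.set1 i))//= big1 ?addr0.
  rewrite !ffunE eqxx mulr1 symdiff_eq.
  by case: eqP => [->|]; rewrite ?mulr0// symdiffK clsgn1.
by move=> A /negPf A0; rewrite ffunE A0 mulr0 mul0r.
Qed.

Lemma gen_sqr (i : 'I_N) : gen R i ** gen R i = - clone R N.
Proof.
by apply/ffunP=> C; rewrite gen_mulE leqnn symdiffv !ffunE expr1 mulN1r.
Qed.

Lemma gen_anti (i j : 'I_N) : i != j -> gen R i ** gen R j = - (gen R j ** gen R i).
Proof.
move=> ij; apply/ffunP=> C; rewrite [RHS]ffunE !gen_mulE symdiffC.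
have := ij; rewrite -(inj_eq val_inj) /=.
by case: ltngtP => // _ _; rewrite ?expr0 ?expr1 ?mulN1r ?mul1r ?opprK.
Qed.

Definition cl_linear (M : nat) (L : Cl R N -> Cl R M) :=
  forall c x y, L (clscale c x + y) = clscale c (L x) + L y.

Definition blade A : Cl R N := [ffun S => (S == A)%:R].

Lemma blade_decomp x : x = \sum_A clscale (x A) (blade A).
Proof.
apply/ffunP=> C; rewrite sum_ffunE (bigD1 C)//= big1 ?addr0.
  by rewrite !ffunE eqxx mulr1.
by move=> A AneC; rewrite !ffunE eq_sym (negPf AneC) mulr0.
Qed.

Lemma cl_linear0 M (L : Cl R N -> Cl R M) : cl_linear L -> L 0 = 0.
Proof.
move=> lL; have := lL (-1) 0 0; rewrite clscaler0 add0r => {1}->.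
by apply/ffunP=> S; rewrite !ffunE mulN1r addNr.
Qed.

Lemma cl_linearD M (L : Cl R N -> Cl R M) x y : cl_linear L -> L (x + y) = L x + L y.
Proof.
move=> lL; rewrite -{1}(clscale1 x) lL.
by congr (_ + _); apply/ffunP=> S; rewrite ffunE mul1r.
Qed.

Lemma cl_linearZ M (L : Cl R N -> Cl R M) c x :
  cl_linear L -> L (clscale c x) = clscale c (L x).
Proof. by move=> lL; rewrite -[clscale c x]addr0 lL cl_linear0// addr0. Qed.

Lemma cl_linear_sum M (L : Cl R N -> Cl R M) (I : Type) (s : seq I) (P : pred I)
    (F : I -> Cl R N) : cl_linear L ->
  L (\sum_(i <- s | P i) F i) = \sum_(i <- s | P i) L (F i).
Proof.
move=> lL; exact: (big_morph L (fun u v => cl_linearD u v lL) (cl_linear0 lL)).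
Qed.

Lemma cl_linear_coord M (L : Cl R N -> Cl R M) x S : cl_linear L ->
  L x S = \sum_A L (blade A) S * x A.
Proof.
move=> lL; rewrite {1}[x]blade_decomp cl_linear_sum// sum_ffunE.
by apply: eq_bigr => A _; rewrite cl_linearZ// ffunE mulrC.
Qed.

Lemma cl_linear_mull a : cl_linear (clmul a).
Proof. by move=> c x y; rewrite clmulDr clmulZr. Qed.

Lemma cl_linear_mulr a : cl_linear (fun x => x ** a).
Proof. by move=> c x y; rewrite clmulDl clmulZl. Qed.

Lemma cl_linear_id : cl_linear (fun x => x).
Proof. by []. Qed.

Lemma cl_linear_scale c : cl_linear (clscale c).
Proof. by move=> d x y; rewrite clscaleDr !clscaleA mulrC. Qed.

Lemma cl_linear_comp (L L' : Cl R N -> Cl R N) :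
  cl_linear L -> cl_linear L' -> cl_linear (fun x => L (L' x)).
Proof. by move=> lL lL' c x y; rewrite lL' lL. Qed.

Lemma cl_linear_add (L L' : Cl R N -> Cl R N) :
  cl_linear L -> cl_linear L' -> cl_linear (fun x => L x + L' x).
Proof. by move=> lL lL' c x y; rewrite lL' lL clscaleDr addrACA. Qed.

Lemma cl_linear_opp : cl_linear -%R.
Proof. by move=> c x y; rewrite -!clscaleN1 clscaleDr !clscaleA mulrC. Qed.

End CliffordAlgebra.

Section Schwarz.
Set Implicit Arguments.
Unset Strict Implicit.
Variables (R : realType) (V : normedModType R).
Implicit Types (f : V -> R) (y u v : V).

Lemma is_derive_line f y u (s : R) : derivable f (y + s *: u) u ->
  is_derive s 1 (fun t : R => f (y + t *: u)) ('D_u f (y + s *: u)).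
Proof.
have E : (fun h : R => h^-1 *: (((fun t : R => f (y + t *: u)) \o shift s) (h *: 1)
    - f (y + s *: u))) =
    (fun h => h^-1 *: ((f \o shift (y + s *: u)) (h *: u) - f (y + s *: u))).
  apply/funext => h /=; congr (_ *: (f _ - _)).
  by rewrite [h *: (1 : R)]mulr1 scalerDl addrCA.
by move=> df; apply: DeriveDef; rewrite /derivable /derive E.
Qed.

Lemma MVT_line f y u (h : R) : 0 < h ->
  (forall s, 0 <= s <= h -> derivable f (y + s *: u) u) ->
  exists2 s, 0 < s < h & f (y + h *: u) - f y = h * 'D_u f (y + s *: u).
Proof.
move=> h0 df; pose g (t : R) := f (y + t *: u).
have dg s : 0 <= s <= h -> is_derive s 1 g ('D_u f (y + s *: u)).
  by move=> /df /is_derive_line.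
have [||s] := @MVT R g (fun s => 'D_u f (y + s *: u)) 0 h h0.
- by move=> s; rewrite in_itv /= => /andP[s0 sh]; apply: dg; rewrite !ltW.
- apply: derivable_within_continuous => s; rewrite in_itv /= => /dg dgs.
  exact: ex_derive.
- rewrite in_itv /= => sh; rewrite /g scale0r addr0 subr0 => E.
  by exists s => //; rewrite E mulrC.
Qed.

Lemma second_difference f y u v (h : R) : 0 < h ->
  (forall s t, 0 <= s <= h -> 0 <= t <= h ->
    derivable f (y + s *: u + t *: v) u /\
    derivable ('D_u f) (y + s *: u + t *: v) v) ->
  exists s t, [/\ 0 < s < h, 0 < t < h &
    f (y + h *: u + h *: v) - f (y + h *: u) - (f (y + h *: v) - f y) =
    h ^+ 2 * 'D_v ('D_u f) (y + s *: u + t *: v)].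
Proof.
move=> h0 df.
have h1 : 0 <= h <= h by rewrite lexx ltW.
have h2 : (0 : R) <= 0 <= h by rewrite lexx ltW.
pose g q := f (q + h *: v) - f q.
have dg s : 0 <= s <= h -> is_derive (y + s *: u) u g
    ('D_u f (y + s *: u + h *: v) - 'D_u f (y + s *: u)).
  move=> sh; have [d1 _] := df _ _ sh h1; have [d2 _] := df _ _ sh h2.
  rewrite scale0r addr0 in d2.
  have E : (fun k : R => k^-1 *: (((fun q => f (q + h *: v)) \o shift (y + s *: u)) (k *: u)
      - f (y + s *: u + h *: v))) = (fun k =>
      k^-1 *: ((f \o shift (y + s *: u + h *: v)) (k *: u) - f (y + s *: u + h *: v))).
    by apply/funext => k /=; congr (_ *: (f _ - _)); rewrite -addrA.
  apply: is_deriveB; first by apply: DeriveDef; rewrite /derivable /derive E.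
  exact: derivableP.
have [|s sh] := @MVT_line g y u h h0.
  by move=> s /dg ds; exact: ex_derive.
have sh' : 0 <= s <= h by case/andP: sh => s0 s1; rewrite !ltW.
have -> : 'D_u g (y + s *: u) = 'D_u f (y + s *: u + h *: v) - 'D_u f (y + s *: u).
  by have [] := dg s sh'.
have [|t th ->] := @MVT_line ('D_u f) (y + s *: u) v h h0.
  by move=> t th; have [] := df _ _ sh' th.
by rewrite /g => E; exists s, t; split=> //; rewrite E mulrA.
Qed.

Lemma derive_comm f y u v :
  (\forall q \near y, derivable f q u /\ derivable ('D_u f) q v) ->
  (\forall q \near y, derivable f q v /\ derivable ('D_v f) q u) ->
  {for y, continuous ('D_v ('D_u f))} -> {for y, continuous ('D_u ('D_v f))} ->
  'D_v ('D_u f) y = 'D_u ('D_v f) y.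
Proof.
move=> d1 d2 c1 c2; apply/eqP; rewrite -subr_eq0 -normr_le0 leNgt; apply/negP => ab.
set a := 'D_v ('D_u f) y in ab; set b := 'D_u ('D_v f) y in ab.
have e0 : 0 < `|a - b| / 2 by rewrite divr_gt0.
have {}c1 : \forall q \near y, `|a - 'D_v ('D_u f) q| < `|a - b| / 2.
  by move/cvgrPdist_lt : c1; apply.
have {}c2 : \forall q \near y, `|b - 'D_u ('D_v f) q| < `|a - b| / 2.
  by move/cvgrPdist_lt : c2; apply.
have /nbhs_ballP[d /= dpos H] : \forall q \near y,
  ((derivable f q u /\ derivable ('D_u f) q v) /\
   (derivable f q v /\ derivable ('D_v f) q u)) /\
  (`|a - 'D_v ('D_u f) q| < `|a - b| / 2 /\ `|b - 'D_u ('D_v f) q| < `|a - b| / 2).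
  have F : Filter (nbhs y) by exact: nbhs_filter.
  exact: (@filterI _ _ F _ _ (@filterI _ _ F _ _ d1 d2) (@filterI _ _ F _ _ c1 c2)).
pose K := `|u| + `|v| + 1.
have K0 : 0 < K by rewrite ltr_pwDr// addr_ge0.
pose h := d / K.
have h0 : 0 < h by rewrite divr_gt0.
have inb s t : 0 <= s <= h -> 0 <= t <= h -> ball y d (y + s *: u + t *: v).
  move=> /andP[s0 sh] /andP[t0 th].
  rewrite -ball_normE /ball_ /= -addrA opprD addrA subrr add0r normrN.
  apply: le_lt_trans (ler_normD _ _) _; rewrite !normrZ !ger0_norm//.
  apply: (@le_lt_trans _ _ (h * (`|u| + `|v|))).
    by rewrite mulrDr lerD// ler_wpM2r.
  have -> : d = h * K by rewrite /h divfK// gt_eqF.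
  by rewrite ltr_pM2l// /K ltrDl.
have [|s [t [sh th E1]]] := @second_difference f y u v h h0.
  by move=> s t sh th; have [[]] := H _ (inb _ _ sh th).
have [|t' [s' [th' sh' E2]]] := @second_difference f y v u h h0.
  by move=> t' s' th' sh'; rewrite addrAC; have [[_ ?] _] := H _ (inb _ _ sh' th').
have ltlt x : 0 < x < h -> 0 <= x <= h by move=> /andP[? ?]; rewrite !ltW.
have [_ [H1 _]] := H _ (inb _ _ (ltlt _ sh) (ltlt _ th)).
have [_ [_ H2]] := H _ (inb _ _ (ltlt _ sh') (ltlt _ th')).
rewrite addrAC in H2.
have swap (p q r w : R) : p - q - (r - w) = p - r - (q - w) by ring.
have E : 'D_v ('D_u f) (y + s *: u + t *: v) = 'D_u ('D_v f) (y + t' *: v + s' *: u).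
  apply: (mulfI (x := h ^+ 2)); first by rewrite expf_neq0// gt_eqF.
  by apply: (etrans (esym E1)); apply: (etrans _ E2); rewrite (addrAC y (h *: v)); exact: swap.
rewrite E in H1.
move: H1 H2 ab; rewrite -/a -/b; move: ('D_u ('D_v f) _) (a : R) (b : R) => c a' b'.
move=> {E1 E2 E c1 c2 H d1 d2 e0}; rewrite [ `|b' - c|]distrC => H1 H2 ab'.
have := le_lt_trans (ler_distD c a' b') (ltrD H1 H2).
by rewrite -splitr ltxx.
Qed.

End Schwarz.

Section CliffordCalculus.
Set Implicit Arguments.
Unset Strict Implicit.
Variables (R : realType) (n : nat).
Implicit Types (f g : 'rV[R]_n -> Cl R n.+1) (U : set 'rV[R]_n) (y : 'rV[R]_n).

Definition is_pdy (j : 'I_n) f y (a : Cl R n.+1) :=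
  forall S, is_derive y (ydir R j) (fun q => f q S) (a S).

Lemma is_pdyP j f y : pdyable j f y -> is_pdy j f y (pdy j f y).
Proof. by move=> df S; rewrite ffunE; exact/derivableP/df. Qed.

Lemma is_pdy_able j f y a : is_pdy j f y a -> pdyable j f y.
Proof. by move=> df S; have [] := df S. Qed.

Lemma is_pdy_val j f y a : is_pdy j f y a -> pdy j f y = a.
Proof. by move=> df; apply/ffunP => S; rewrite ffunE; have [] := df S. Qed.

Lemma is_derive_lincomb (V : normedModType R) (I : finType) (c : I -> R)
    (h : I -> V -> R) (d : I -> R) (x v : V) :
  (forall i, is_derive x v (h i) (d i)) ->
  is_derive x v (fun q => \sum_i c i * h i q) (\sum_i c i * d i).
Proof.
move=> dh; have -> : (fun q => \sum_i c i * h i q) = \sum_i (c i *: h i).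
  by apply/funext => q; rewrite fct_sumE.
by elim/big_ind2 : _ => [|? ? ? ? ? ?|i _]; [exact: is_derive_cst|exact: is_deriveD|
  exact: is_deriveZ].
Qed.

Lemma is_derive_cl_linear (V : normedModType R) (N M : nat) (L : Cl R N -> Cl R M)
    (h : V -> Cl R N) (a : Cl R N) (x v : V) : cl_linear L ->
  (forall S, is_derive x v (fun q => h q S) (a S)) ->
  forall S, is_derive x v (fun q => L (h q) S) (L a S).
Proof.
move=> lL dh S; rewrite (cl_linear_coord _ _ lL).
have -> : (fun q => L (h q) S) = (fun q => \sum_A L (blade R A) S * h q A).
  by apply/funext => q; rewrite (cl_linear_coord _ _ lL).
exact: is_derive_lincomb.
Qed.

Lemma is_derive_clD (V : normedModType R) (N : nat) (h k : V -> Cl R N)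
    (a b : Cl R N) (x v : V) :
  (forall S, is_derive x v (fun q => h q S) (a S)) ->
  (forall S, is_derive x v (fun q => k q S) (b S)) ->
  forall S, is_derive x v (fun q => (h q + k q) S) ((a + b) S).
Proof.
move=> dh dk S; rewrite ffunE.
have -> : (fun q => (h q + k q) S) = (fun q => h q S) + (fun q => k q S).
  by apply/funext => q; rewrite ffunE.
exact: is_deriveD.
Qed.

Lemma cvg_lincomb (T : Type) (F : set_system T) (FF : Filter F) (I : finType)
    (c : I -> R) (h : I -> T -> R) (l : I -> R) : (forall i, h i @ F --> l i) ->
  (fun q => \sum_i c i * h i q) @ F --> \sum_i c i * l i.
Proof.
move=> hl; elim: (index_enum I) => [|i s IH].
  by rewrite big_nil; under eq_fun do rewrite big_nil; exact: cvg_cst.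
rewrite big_cons; under eq_fun do rewrite big_cons.
by apply: cvgD => //; apply: cvgM => //; exact: cvg_cst.
Qed.

Lemma is_pdy_linear j f y a (L : Cl R n.+1 -> Cl R n.+1) : cl_linear L ->
  is_pdy j f y a -> is_pdy j (fun q => L (f q)) y (L a).
Proof. exact: is_derive_cl_linear. Qed.

Lemma is_pdyD j f g y a b :
  is_pdy j f y a -> is_pdy j g y b -> is_pdy j (fun q => f q + g q) y (a + b).
Proof. exact: is_derive_clD. Qed.

Lemma is_pdy0 j y : is_pdy j (fun=> 0) y 0.
Proof. by move=> S; rewrite ffunE; exact: is_derive_cst. Qed.

Lemma is_pdy_sum j (I : Type) (s : seq I) (F : I -> 'rV[R]_n -> Cl R n.+1)
    (a : I -> Cl R n.+1) y : (forall i, is_pdy j (F i) y (a i)) ->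
  is_pdy j (fun q => \sum_(i <- s) F i q) y (\sum_(i <- s) a i).
Proof.
move=> dF; elim: s => [|i s IH].
  by rewrite big_nil; under eq_fun do rewrite big_nil; exact: is_pdy0.
by rewrite big_cons; under eq_fun do rewrite big_cons; exact: is_pdyD.
Qed.

Lemma is_pdy_near j f g y a : (\forall q \near y, f q = g q) ->
  is_pdy j f y a -> is_pdy j g y a.
Proof.
move=> fg df S; apply: near_eq_is_derive (df S).
by move: fg; apply: filterS => q ->.
Qed.

Lemma near_open U y (P : 'rV[R]_n -> Prop) : open U -> U y ->
  (forall q, U q -> P q) -> \forall q \near y, P q.
Proof. by move=> oU Uy HP; apply: filterS HP (open_nbhs_nbhs (conj oU Uy)). Qed.

Lemma smooth_pdyable U f j y : smooth_on U f -> U y -> pdyable j f y.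
Proof. by move=> sf Uy; have [] := sf [::] y Uy. Qed.

Lemma smooth_pdy U f j : smooth_on U f -> smooth_on U (pdy j f).
Proof.
move=> sf s y Uy; have := sf (rcons s j) y Uy.
by rewrite /itpd foldr_rcons.
Qed.

Lemma smooth0 U : smooth_on U (fun=> 0 : Cl R n.+1).
Proof.
have E s : itpd s (fun=> 0 : Cl R n.+1) = (fun=> 0).
  elim: s => // j s IH; apply/funext => q; rewrite /= -/(itpd _ _) IH.
  exact: (is_pdy_val (is_pdy0 _ _)).
move=> s y Uy; rewrite E; split=> [j|S]; first exact: (is_pdy_able (is_pdy0 _ _)).
by have -> : (fun q : 'rV[R]_n => (0 : Cl R n.+1) S) = cst ((0 : Cl R n.+1) S) by [];
  exact: cst_continuous.
Qed.

Lemma itpd_linear U f (L : Cl R n.+1 -> Cl R n.+1) s y : open U -> cl_linear L ->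
  smooth_on U f -> U y -> itpd s (fun q => L (f q)) y = L (itpd s f y).
Proof.
move=> oU lL sf; elim: s y => // j s IH y Uy; rewrite /= -!/(itpd _ _).
apply: is_pdy_val; apply: (@is_pdy_near j (fun q => L (itpd s f q))).
  by apply: (near_open oU Uy) => q Uq; rewrite IH.
by apply: is_pdy_linear => //; apply/is_pdyP; have [] := sf s y Uy.
Qed.

Lemma itpdD U f g s y : open U -> smooth_on U f -> smooth_on U g -> U y ->
  itpd s (fun q => f q + g q) y = itpd s f y + itpd s g y.
Proof.
move=> oU sf sg; elim: s y => // j s IH y Uy; rewrite /= -!/(itpd _ _).
apply: is_pdy_val; apply: (@is_pdy_near j (fun q => itpd s f q + itpd s g q)).
  by apply: (near_open oU Uy) => q Uq; rewrite IH.
by apply: is_pdyD; apply/is_pdyP; [have [] := sf s y Uy|have [] := sg s y Uy].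
Qed.

Lemma near_continuous (f g : 'rV[R]_n -> R) y : (\forall q \near y, f q = g q) ->
  {for y, continuous f} -> {for y, continuous g}.
Proof.
move=> fg cf; rewrite /prop_for /continuous_at -(nbhs_singleton fg).
exact: cvg_trans (near_eq_cvg fg) cf.
Qed.

Lemma smooth_linear U f (L : Cl R n.+1 -> Cl R n.+1) : open U -> cl_linear L ->
  smooth_on U f -> smooth_on U (fun q => L (f q)).
Proof.
move=> oU lL sf s y Uy; have [df cf] := sf s y Uy.
have E : \forall q \near y, L (itpd s f q) = itpd s (fun q => L (f q)) q.
  by apply: (near_open oU Uy) => q Uq; rewrite (itpd_linear _ oU).
split=> [j|S].
  apply: is_pdy_able; apply: is_pdy_near E _; apply: is_pdy_linear => //.
  exact/is_pdyP.
apply: (@near_continuous (fun q => L (itpd s f q) S)).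
  by move: E; apply: filterS => q ->.
rewrite (_ : (fun q => _) = (fun q => \sum_A L (blade R A) S * itpd s f q A)); last first.
  by apply/funext => q; rewrite (cl_linear_coord _ _ lL).
rewrite /prop_for /continuous_at; apply: (@cvg_lincomb _ (nbhs y) (nbhs_filter y)) => A.
exact: cf.
Qed.

Lemma smoothD U f g : open U -> smooth_on U f -> smooth_on U g ->
  smooth_on U (fun q => f q + g q).
Proof.
move=> oU sf sg s y Uy; have [df cf] := sf s y Uy; have [dg cg] := sg s y Uy.
have E : \forall q \near y, itpd s f q + itpd s g q = itpd s (fun q => f q + g q) q.
  by apply: (near_open oU Uy) => q Uq; rewrite (itpdD _ oU).
split=> [j|S].
  by apply: is_pdy_able; apply: is_pdy_near E _; apply: is_pdyD; exact/is_pdyP.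
apply: (@near_continuous (fun q => (itpd s f q + itpd s g q) S)).
  by move: E; apply: filterS => q ->.
rewrite (_ : (fun q => _) = (fun q => itpd s f q S + itpd s g q S)); last first.
  by apply/funext => q; rewrite ffunE.
exact: (cvgD (cf S) (cg S)).
Qed.

Lemma smooth_sum U (I : Type) (s : seq I) (F : I -> 'rV[R]_n -> Cl R n.+1) :
  open U -> (forall i, smooth_on U (F i)) -> smooth_on U (fun q => \sum_(i <- s) F i q).
Proof.
move=> oU sF; elim: s => [|i s IH].
  by under eq_fun do rewrite big_nil; exact: smooth0.
by under eq_fun do rewrite big_cons; exact: smoothD.
Qed.

Lemma smooth_diracL U f : open U -> smooth_on U f -> smooth_on U (diracL f).
Proof.
move=> oU sf; apply: smooth_sum => // j.
by apply: smooth_linear (smooth_pdy _ _) => //; exact: cl_linear_mull.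
Qed.

Lemma pdyC U f i j y : open U -> smooth_on U f -> U y ->
  pdy i (pdy j f) y = pdy j (pdy i f) y.
Proof.
move=> oU sf Uy; apply/ffunP => S; rewrite [LHS]ffunE [RHS]ffunE.
have E k : (fun q => pdy k f q S) = 'D_(ydir R k) (fun q => f q S).
  by apply/funext => q; rewrite ffunE.
have D k l q : U q -> derivable (fun q => f q S) q (ydir R k) /\
    derivable ('D_(ydir R k) (fun q => f q S)) q (ydir R l).
  move=> Uq; rewrite -E; split; first exact: (smooth_pdyable sf Uq).
  exact: (smooth_pdyable (smooth_pdy k sf) Uq).
have C k l : {for y, continuous ('D_(ydir R l) ('D_(ydir R k) (fun q => f q S)))}.
  have <- : (fun q => pdy l (pdy k f) q S) =
      'D_(ydir R l) ('D_(ydir R k) (fun q => f q S)).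
    by apply/funext => q; rewrite ffunE E.
  by have [_] := sf [:: l; k] y Uy; exact.
by rewrite !E; apply: derive_comm => //; apply: (near_open oU Uy); exact: D.
Qed.

End CliffordCalculus.

Section DiracOperators.
Set Implicit Arguments.
Unset Strict Implicit.
Variables (R : realType) (n : nat).
Implicit Types (f g : 'rV[R]_n -> Cl R n.+1) (U : set 'rV[R]_n) (y : 'rV[R]_n).
Implicit Types (x : Cl R n.+1) (i j : 'I_n).
Local Notation i1 := (e1 R n).
Local Notation e := (ey R).

Lemma e1_sqr : i1 ** i1 = - clone R n.+1.
Proof. exact: gen_sqr. Qed.

Lemma e1_mulK x : i1 ** (i1 ** x) = - x.
Proof. by rewrite clmulA e1_sqr clmulNl clmul1l. Qed.

Lemma e1_mulKr x : x ** i1 ** i1 = - x.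
Proof. by rewrite -clmulA e1_sqr clmulNr clmul1r. Qed.

Lemma ey_sqr j : e j ** e j = - clone R n.+1.
Proof. exact: gen_sqr. Qed.

Lemma ey_anti i j : i != j -> e i ** e j = - (e j ** e i).
Proof. by move=> ij; apply: gen_anti; rewrite (inj_eq lift_inj). Qed.

Lemma ey_e1 j : e j ** i1 = - (i1 ** e j).
Proof. by apply: gen_anti; rewrite eq_sym neq_lift. Qed.

Lemma cl_double_inj (N : nat) (u v : Cl R N) : u + u = v + v -> u = v.
Proof.
move=> uv; apply/ffunP => S; have := congr1 (fun w : Cl R N => w S) uv.
by rewrite !ffunE; lra.
Qed.

Lemma anticommuting_suml (g : 'I_n -> 'I_n -> Cl R n.+1) :
  (forall i j, g i j = g j i) ->
  \sum_i e i ** (\sum_j e j ** g i j) = - \sum_i g i i.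
Proof.
move=> gC; apply: cl_double_inj; set X := \sum_i e i ** (\sum_j e j ** g i j).
have E : X = \sum_i \sum_j e i ** e j ** g i j.
  by apply: eq_bigr => i _; rewrite clmul_sumr; apply: eq_bigr => j _; rewrite clmulA.
have {2}-> : X = \sum_i \sum_j e j ** e i ** g i j.
  rewrite E exchange_big; apply: eq_bigr => i _; apply: eq_bigr => j _.
  by rewrite gC.
rewrite E -!big_split -opprD -big_split -sumrN /=; apply: eq_bigr => i _.
rewrite -big_split (bigD1 i)//= big1 ?addr0.
  by rewrite ey_sqr clmulNl clmul1l opprD.
by move=> j ji; rewrite (ey_anti ji) clmulNl subrr.
Qed.

Lemma anticommuting_sumr (g : 'I_n -> 'I_n -> Cl R n.+1) :
  (forall i j, g i j = g j i) ->
  \sum_i (\sum_j g i j ** e j) ** e i = - \sum_i g i i.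
Proof.
move=> gC; apply: cl_double_inj; set X := \sum_i (\sum_j g i j ** e j) ** e i.
have E : X = \sum_i \sum_j g i j ** (e j ** e i).
  by apply: eq_bigr => i _; rewrite clmul_suml; apply: eq_bigr => j _; rewrite clmulA.
have {2}-> : X = \sum_i \sum_j g i j ** (e i ** e j).
  rewrite E exchange_big; apply: eq_bigr => i _; apply: eq_bigr => j _.
  by rewrite gC.
rewrite E -!big_split -opprD -big_split -sumrN /=; apply: eq_bigr => i _.
rewrite -big_split (bigD1 i)//= big1 ?addr0.
  by rewrite ey_sqr clmulNr clmul1r opprD.
by move=> j ji; rewrite (ey_anti ji) clmulNr addNr.
Qed.

Lemma diracL_val f y (a : 'I_n -> Cl R n.+1) :
  (forall j, is_pdy j f y (a j)) -> diracL f y = \sum_j e j ** a j.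
Proof. by move=> df; apply: eq_bigr => j _; rewrite (is_pdy_val (df j)). Qed.

Lemma diracR_val f y (a : 'I_n -> Cl R n.+1) :
  (forall j, is_pdy j f y (a j)) -> diracR f y = \sum_j a j ** e j.
Proof. by move=> df; apply: eq_bigr => j _; rewrite (is_pdy_val (df j)). Qed.

Lemma diracL_linear U f y (L L' : Cl R n.+1 -> Cl R n.+1) :
  cl_linear L -> cl_linear L' -> (forall j x, e j ** L x = L' (e j ** x)) ->
  smooth_on U f -> U y -> diracL (fun q => L (f q)) y = L' (diracL f y).
Proof.
move=> lL lL' LL' sf Uy; rewrite /diracL cl_linear_sum//.
rewrite -/(diracL _ _) (@diracL_val _ _ (fun j => L (pdy j f y))).
  by apply: eq_bigr => j _; rewrite LL'.
by move=> j; apply: is_pdy_linear => //; apply/is_pdyP/(smooth_pdyable sf).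
Qed.

Lemma diracR_linear U f y (L L' : Cl R n.+1 -> Cl R n.+1) :
  cl_linear L -> cl_linear L' -> (forall j x, L x ** e j = L' (x ** e j)) ->
  smooth_on U f -> U y -> diracR (fun q => L (f q)) y = L' (diracR f y).
Proof.
move=> lL lL' LL' sf Uy; rewrite /diracR cl_linear_sum//.
rewrite -/(diracR _ _) (@diracR_val _ _ (fun j => L (pdy j f y))).
  by apply: eq_bigr => j _; rewrite LL'.
by move=> j; apply: is_pdy_linear => //; apply/is_pdyP/(smooth_pdyable sf).
Qed.

Lemma diracLD U f g y : smooth_on U f -> smooth_on U g -> U y ->
  diracL (fun q => f q + g q) y = diracL f y + diracL g y.
Proof.
move=> sf sg Uy; rewrite (@diracL_val _ _ (fun j => pdy j f y + pdy j g y)).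
  by rewrite -big_split; apply: eq_bigr => j _; rewrite clmulDr.
by move=> j; apply: is_pdyD; apply/is_pdyP; [exact: smooth_pdyable sf _|
  exact: smooth_pdyable sg _].
Qed.

Lemma diracL_near U f g y : open U -> smooth_on U f -> U y ->
  (forall q, U q -> f q = g q) -> diracL g y = diracL f y.
Proof.
move=> oU sf Uy fg; apply: diracL_val => j.
apply: is_pdy_near (near_open oU Uy fg) _.
exact/is_pdyP/(smooth_pdyable sf).
Qed.

Lemma diracR_near U f g y : open U -> smooth_on U f -> U y ->
  (forall q, U q -> f q = g q) -> diracR g y = diracR f y.
Proof.
move=> oU sf Uy fg; apply: diracR_val => j.
apply: is_pdy_near (near_open oU Uy fg) _.
exact/is_pdyP/(smooth_pdyable sf).
Qed.

Lemma diracL0 y : diracL (fun=> 0 : Cl R n.+1) y = 0.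
Proof.
rewrite (diracL_val (fun j => is_pdy0 j y)) big1// => j _.
by rewrite clmul0r.
Qed.

Lemma diracR0 y : diracR (fun=> 0 : Cl R n.+1) y = 0.
Proof.
rewrite (diracR_val (fun j => is_pdy0 j y)) big1// => j _.
by rewrite clmul0l.
Qed.

Lemma is_pdy_diracL U f y i : smooth_on U f -> U y ->
  is_pdy i (diracL f) y (\sum_j e j ** pdy i (pdy j f) y).
Proof.
move=> sf Uy; apply: is_pdy_sum => j.
apply: is_pdy_linear; first exact: cl_linear_mull.
exact/is_pdyP/(smooth_pdyable (smooth_pdy j sf)).
Qed.

Lemma is_pdy_diracR U f y i : smooth_on U f -> U y ->
  is_pdy i (diracR f) y (\sum_j pdy i (pdy j f) y ** e j).
Proof.
move=> sf Uy; apply: is_pdy_sum => j.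
apply: (@is_pdy_linear _ _ _ _ _ _ (fun x => x ** e j)); first exact: cl_linear_mulr.
exact/is_pdyP/(smooth_pdyable (smooth_pdy j sf)).
Qed.

Lemma diracL_sqr U f y : open U -> smooth_on U f -> U y ->
  diracL (diracL f) y = - laplacian f y.
Proof.
move=> oU sf Uy; rewrite (diracL_val (fun i => is_pdy_diracL i sf Uy)).
by apply: anticommuting_suml => i j; exact: (pdyC i j oU sf Uy).
Qed.

Lemma diracR_sqr U f y : open U -> smooth_on U f -> U y ->
  diracR (diracR f) y = - laplacian f y.
Proof.
move=> oU sf Uy; rewrite (diracR_val (fun i => is_pdy_diracR i sf Uy)).
by apply: anticommuting_sumr => i j; exact: (pdyC i j oU sf Uy).
Qed.

Lemma diracLR U f y : open U -> smooth_on U f -> U y ->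
  diracL (diracR f) y = diracR (diracL f) y.
Proof.
move=> oU sf Uy; rewrite (diracL_val (fun i => is_pdy_diracR i sf Uy)).
rewrite (diracR_val (fun i => is_pdy_diracL i sf Uy)).
under eq_bigr do rewrite clmul_sumr.
under [RHS]eq_bigr do rewrite clmul_suml.
rewrite exchange_big; apply: eq_bigr => i _; apply: eq_bigr => j _.
by rewrite -clmulA (pdyC j i oU sf Uy).
Qed.

Definition conj1 (x : Cl R n.+1) : Cl R n.+1 := i1 ** x ** i1.

Lemma cl_linear_conj1 : cl_linear conj1.
Proof. by move=> c x x'; rewrite /conj1 clmulDr clmulDl clmulZr clmulZl. Qed.

Lemma conj1K : involutive conj1.
Proof. by move=> x; rewrite /conj1 !clmulA e1_mulKr -clmulA -!clmulNr e1_mulK opprK. Qed.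

Lemma ey_conj1 j x : e j ** conj1 x = - conj1 (e j ** x).
Proof. by rewrite /conj1 !clmulA ey_e1 !clmulNl. Qed.

Lemma conj1_ey j x : conj1 x ** e j = - conj1 (x ** e j).
Proof. by rewrite /conj1 -!clmulA (ey_e1 j) !clmulNr opprK. Qed.

Lemma diracLZ U f y (c : R) : smooth_on U f -> U y ->
  diracL (fun q => clscale c (f q)) y = clscale c (diracL f y).
Proof.
apply: diracL_linear; [exact: cl_linear_scale|exact: cl_linear_scale|].
by move=> j x; rewrite clmulZr.
Qed.

Lemma diracRZ U f y (c : R) : smooth_on U f -> U y ->
  diracR (fun q => clscale c (f q)) y = clscale c (diracR f y).
Proof.
apply: diracR_linear; [exact: cl_linear_scale|exact: cl_linear_scale|].
by move=> j x; rewrite clmulZl.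
Qed.

End DiracOperators.

Section Powers.
Set Implicit Arguments.
Unset Strict Implicit.
Variables (R : realType) (n : nat).
Implicit Types (a b s c : R) (x y : Cl R n.+1) (k : nat).
Local Notation i1 := (e1 R n).

Fixpoint cpow (k : nat) (a b : R) : R * R :=
  if k is k'.+1 then
    let p := cpow k' a b in (a * p.1 - b * p.2, a * p.2 + b * p.1)
  else (1, 0).

Lemma cpowZ k c a b :
  cpow k (c * a) (c * b) = (c ^+ k * (cpow k a b).1, c ^+ k * (cpow k a b).2).
Proof.
elim: k => [|k IH] /=; first by rewrite !mul1r.
by rewrite IH /= exprS; congr pair; ring.
Qed.

Definition zpow s (k : nat) a b (x : Cl R n.+1) : Cl R n.+1 :=
  clscale (cpow k a (s * b)).1 x + clscale (cpow k a (s * b)).2 (i1 ** x).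

Lemma clpow_zzE k a b x : clpow (zz n a b) k ** x = zpow 1 k a b x.
Proof.
rewrite /zpow mul1r; elim: k => [|k IH] /=.
  by rewrite clmul1l clscale1 clscale0 addr0.
rewrite -/(clpow _ _) -clmulA IH /zz clmulDl !clmulZl clmul1l clmulDr !clmulZr e1_mulK.
by apply/ffunP => S; rewrite !ffunE; ring.
Qed.

Lemma clpow_zzbarE k a b x : clpow (zzbar n a b) k ** x = zpow (-1) k a b x.
Proof.
have -> : zzbar n a b = zz n a (- b).
  by apply/ffunP => S; rewrite /zz /zzbar !ffunE; ring.
by rewrite clpow_zzE /zpow mul1r mulN1r.
Qed.

Lemma cl_linear_zpow s k a b : cl_linear (zpow s k a b).
Proof.
by move=> c x y; rewrite /zpow clmulDr clmulZr; apply/ffunP => S; rewrite !ffunE; ring.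
Qed.

Lemma zpow0 s a b x : zpow s 0 a b x = x.
Proof. by rewrite /zpow /= clscale1 clscale0 addr0. Qed.

Lemma zpow_homo s k c a b x : zpow s k (c * a) (c * b) x = clscale (c ^+ k) (zpow s k a b x).
Proof.
by rewrite /zpow mulrCA cpowZ; apply/ffunP => S; rewrite !ffunE /=; ring.
Qed.

Lemma zpow_e1 s k a b x : zpow s k a b (i1 ** x) = i1 ** zpow s k a b x.
Proof. by rewrite /zpow clmulDr !clmulZr. Qed.

Lemma zpow_mulr s k a b x y : zpow s k a b (x ** y) = zpow s k a b x ** y.
Proof. by rewrite /zpow clmulDl !clmulZl clmulA. Qed.

Lemma cpowN k a b : cpow k a (- b) = ((cpow k a b).1, - (cpow k a b).2).
Proof.
elim: k => [|k IH] /=; first by rewrite oppr0.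
by rewrite IH /=; congr pair; ring.
Qed.

Lemma ey_zpow s k a b x (j : 'I_n) :
  ey R j ** zpow s k a b x = zpow (- s) k a b (ey R j ** x).
Proof.
rewrite /zpow mulNr cpowN clmulDr !clmulZr clmulA ey_e1 clmulNl -clmulA /=.
by apply/ffunP => S; rewrite !ffunE; ring.
Qed.

Lemma zpow_10 s k x : zpow s k 1 0 x = x.
Proof.
have E : cpow k 1 (0 : R) = (1, 0) by elim: k => //= k ->; rewrite /=; congr pair; ring.
by rewrite /zpow mulr0 E /= clscale1 clscale0 addr0.
Qed.

Lemma is_derive_cpow_l k a b :
  is_derive a 1 (fun t : R => (cpow k t b).1) (k%:R * (cpow k.-1 a b).1) /\
  is_derive a 1 (fun t : R => (cpow k t b).2) (k%:R * (cpow k.-1 a b).2).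
Proof.
elim: k => [|k [IH1 IH2]] /=.
  by rewrite !mul0r; split; exact: is_derive_cst.
have did : is_derive a (1 : R) (fun t : R => t) 1 by exact: is_derive_id.
have dP (h : R -> R) d : is_derive a 1 h d -> is_derive a 1 (fun t => t * h t) (a * d + h a).
  move=> dh; apply: (is_derive_eq (is_deriveM did dh)).
  by rewrite /GRing.scale /= mulr1.
split.
- apply: (is_derive_eq (is_deriveB (dP _ _ IH1) (is_deriveZ b IH2))).
  by rewrite /GRing.scale /=; case: k {IH1 IH2} => [|k] /=; rewrite -?natr1; ring.
- apply: (is_derive_eq (is_deriveD (dP _ _ IH2) (is_deriveZ b IH1))).
  by rewrite /GRing.scale /=; case: k {IH1 IH2} => [|k] /=; rewrite -?natr1; ring.
Qed.

Lemma is_derive_cpow_r s k a b :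
  is_derive b 1 (fun t : R => (cpow k a (s * t)).1) (- (s * k%:R * (cpow k.-1 a (s * b)).2)) /\
  is_derive b 1 (fun t : R => (cpow k a (s * t)).2) (s * k%:R * (cpow k.-1 a (s * b)).1).
Proof.
elim: k => [|k [IH1 IH2]] /=.
  by rewrite !(mulr0, mul0r) oppr0; split; exact: is_derive_cst.
have did : is_derive b (1 : R) (fun t : R => s * t) s.
  apply: (is_derive_eq (is_deriveZ s (is_derive_id b (1 : R)))).
  by rewrite /GRing.scale /= mulr1.
have dP (h : R -> R) d : is_derive b 1 h d ->
    is_derive b 1 (fun t => s * t * h t) (s * b * d + s * h b).
  move=> dh; apply: (is_derive_eq (is_deriveM did dh)).
  by rewrite /GRing.scale /=; ring.
split.
- apply: (is_derive_eq (is_deriveB (is_deriveZ a IH1) (dP _ _ IH2))).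
  by rewrite /GRing.scale /=; case: k {IH1 IH2} => [|k] /=; rewrite -?natr1; ring.
- apply: (is_derive_eq (is_deriveD (is_deriveZ a IH2) (dP _ _ IH1))).
  by rewrite /GRing.scale /=; case: k {IH1 IH2} => [|k] /=; rewrite -?natr1; ring.
Qed.

Lemma is_derive_zpow_l s k a b x S :
  is_derive a 1 (fun t => zpow s k t b x S) (clscale k%:R (zpow s k.-1 a b x) S).
Proof.
have [d1 d2] := is_derive_cpow_l k a (s * b).
have -> : (fun t => zpow s k t b x S) =
    (fun t => x S *: (cpow k t (s * b)).1 + (i1 ** x) S *: (cpow k t (s * b)).2).
  by apply/funext => t; rewrite /zpow !ffunE /GRing.scale /=; ring.
apply: (is_derive_eq (is_deriveD (is_deriveZ (x S) d1) (is_deriveZ _ d2))).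
by rewrite !ffunE /GRing.scale /=; ring.
Qed.

Lemma is_derive_zpow_r s k a b x S :
  is_derive b 1 (fun t => zpow s k a t x S)
    (clscale (s * k%:R) (zpow s k.-1 a b (i1 ** x)) S).
Proof.
have [d1 d2] := is_derive_cpow_r s k a b.
have -> : (fun t => zpow s k a t x S) =
    (fun t => x S *: (cpow k a (s * t)).1 + (i1 ** x) S *: (cpow k a (s * t)).2).
  by apply/funext => t; rewrite /zpow !ffunE /GRing.scale /=; ring.
apply: (is_derive_eq (is_deriveD (is_deriveZ (x S) d1) (is_deriveZ _ d2))).
by rewrite /zpow e1_mulK; rewrite !ffunE /GRing.scale /=; ring.
Qed.

End Powers.

Section PowerSeries.
Set Implicit Arguments.
Unset Strict Implicit.
Variables (R : realType).
Implicit Types (a b t : R) (k : nat).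

Lemma clsum_toP (N : nat) (u : nat -> Cl R N) l :
  clsum_to u l <-> forall S, (fun M : nat => (\sum_(k < M) u k) S) @ \oo --> l S.
Proof.
by split=> H S; have := H S; under eq_fun do rewrite ?sum_ffunE //;
  under [X in _ -> X @ _ --> _]eq_fun do rewrite ?sum_ffunE.
Qed.

Lemma clsum_to_eq (N : nat) (u v : nat -> Cl R N) l :
  (forall k, u k = v k) -> clsum_to u l -> clsum_to v l.
Proof. by move=> /funext ->. Qed.

Lemma clsum_to_linear (N M : nat) (L : Cl R N -> Cl R M) (u : nat -> Cl R N) l :
  cl_linear L -> clsum_to u l -> clsum_to (fun k => L (u k)) (L l).
Proof.
move=> lL /clsum_toP ul; apply/clsum_toP => S.
rewrite (cl_linear_coord _ _ lL).
rewrite (_ : (fun M => _) = (fun M : nat =>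
   \sum_A L (blade R A) S * (\sum_(k < M) u k) A)); last first.
  by apply/funext => m; rewrite -(cl_linear_coord _ _ lL) cl_linear_sum.
exact: cvg_lincomb.
Qed.

Lemma clsum_toD (N : nat) (u v : nat -> Cl R N) l l' :
  clsum_to u l -> clsum_to v l' -> clsum_to (fun k => u k + v k) (l + l').
Proof.
move=> /clsum_toP ul /clsum_toP vl; apply/clsum_toP => S; rewrite ffunE.
rewrite (_ : (fun M => _) = (fun M : nat =>
   (\sum_(k < M) u k) S + (\sum_(k < M) v k) S)); last first.
  by apply/funext => m; rewrite big_split ffunE.
by apply: cvgD; [exact: ul|exact: vl].
Qed.

Lemma clsum_to0 (N : nat) : clsum_to (fun=> 0 : Cl R N) 0.
Proof.
apply/clsum_toP => S; under eq_fun do rewrite big1//.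
exact: cvg_cst.
Qed.

Lemma clsum_to_sum (N n : nat) (u : 'I_n -> nat -> Cl R N) (l : 'I_n -> Cl R N) :
  (forall i, clsum_to (u i) (l i)) ->
  clsum_to (fun k => \sum_i u i k) (\sum_i l i).
Proof.
move=> ul; elim: (index_enum _) => [|i s IH].
  by rewrite big_nil; under eq_fun do rewrite big_nil; exact: clsum_to0.
by rewrite big_cons; under eq_fun do rewrite big_cons; exact: (clsum_toD (ul i) IH).
Qed.

Lemma clsum_to_shift (N : nat) (u : nat -> Cl R N) l :
  u 0%N = 0 -> clsum_to u l -> clsum_to (fun k => u k.+1) l.
Proof.
move=> u0 ul S; have := ul S; rewrite -cvg_shiftS.
by under eq_fun do rewrite big_ord_recl u0 ffunE add0r.
Qed.

Lemma clsum_to_unique (N : nat) (u : nat -> Cl R N) l l' :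
  clsum_to u l -> clsum_to u l' -> l = l'.
Proof. by move=> ul ul'; apply/ffunP => S; exact: cvg_unique (ul S) (ul' S). Qed.

Lemma geometric_tail_le (q : R) (M : nat) : 0 <= q <= 1 / 2 ->
  \sum_(k < M) q ^+ k.+1 <= 2 * q.
Proof.
move=> /andP[q0 q1].
have E : (1 - q) * \sum_(k < M) q ^+ k.+1 = q - q ^+ M.+1.
  elim: M => [|M IH]; first by rewrite big_ord0 mulr0 expr1 subrr.
  by rewrite big_ord_recr /= mulrDr IH [in RHS]exprS; ring.
have S0 : 0 <= \sum_(k < M) q ^+ k.+1 by apply: sumr_ge0 => k _; rewrite exprn_ge0.
have : 0 <= q ^+ M.+1 by rewrite exprn_ge0.
by move: E S0; move: (\sum_(k < M) _) (q ^+ M.+1) => s w; nra.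
Qed.

(* Convergence at [t0] bounds [t0 ^+ k * u k] by [C], so the tail of the series
   at [t <= t0 / 2] is at most [2 * C * t / t0], which is small with [t]. *)
Lemma power_series_zero_head (u : nat -> R) (r : R) : 0 < r ->
  (forall t, 0 < t < r -> (fun M : nat => \sum_(k < M) t ^+ k * u k) @ \oo --> (0 : R)) ->
  u 0%N = 0.
Proof.
move=> r0 H; pose t0 := r / 2.
have t00 : 0 < t0 by rewrite divr_gt0.
have t0r : 0 < t0 < r by rewrite t00 /= /t0; lra.
have [C C0 uC] : exists2 C : R, 0 < C & forall k, `|t0 ^+ k * u k| <= C.
  have cs : cvgn (fun M : nat => \sum_(k < M) t0 ^+ k * u k).
    by apply/cvg_ex; exists 0; exact: H.
  have : cvgn (fun k : nat => t0 ^+ k * u k).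
    apply/cvg_ex; exists (0 - 0).
    rewrite (_ : (fun k : nat => _) = (fun k : nat => \sum_(i < k.+1) t0 ^+ i * u i
         - \sum_(i < k) t0 ^+ i * u i)); last first.
      by apply/funext => k; rewrite big_ord_recr /= addrAC subrr add0r.
    apply: cvgB; last exact: H.
    by rewrite (cvg_shiftS (fun k : nat => \sum_(i < k) t0 ^+ i * u i)); exact: H.
  move=> /cvg_seq_bounded [M [_ HM]]; exists (`|M| + 1); first by rewrite ltr_pwDr.
  by move=> k; apply: HM => //; rewrite (le_lt_trans (ler_norm M))// ltrDl.
apply/eqP/negPn/negP => u0; have {}u0 : 0 < `|u 0%N| by rewrite normr_gt0.
pose q := Num.min (1 / 2) (`|u 0%N| / (4 * C)).
have q0 : 0 < q by rewrite lt_min !divr_gt0// mulr_gt0.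
have q2 : 0 <= q <= 1 / 2 by rewrite ltW//= ge_min lexx.
have qC : q * C <= `|u 0%N| / 4.
  have : q <= `|u 0%N| / (4 * C) by rewrite ge_min lexx orbT.
  by rewrite ler_pdivlMr ?mulr_gt0// ler_pdivlMr//; lra.
have qt : 0 < q * t0 < r.
  rewrite mulr_gt0//=; case/andP: t0r => _; case/andP: q2 => _.
  by move: (q) => p; nra.
have bound M : `|u 0%N| / 2 <= `|\sum_(k < M.+1) (q * t0) ^+ k * u k|.
  rewrite big_ord_recl /= expr0 mul1r.
  apply: le_trans (lerB_normD _ _); rewrite lerBrDl -lerBrDr.
  apply: le_trans (ler_norm_sum _ _ _) _.
  apply: (@le_trans _ _ (\sum_(k < M) q ^+ k.+1 * C)).
    apply: ler_sum => k _; rewrite /bump /= add1n exprMn -mulrA normrM.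
    by rewrite (ger0_norm (exprn_ge0 _ (ltW q0))) ler_wpM2l// exprn_ge0// ltW.
  rewrite -mulr_suml; apply: (@le_trans _ _ (2 * q * C)).
    by apply: ler_wpM2r; [exact: ltW|exact: geometric_tail_le].
  by move: qC; rewrite -mulrA; lra.
have := H _ qt; rewrite -cvg_shiftS => /cvgrPdist_lt /(_ (`|u 0%N| / 2)).
rewrite divr_gt0// => /(_ isT) [m _ /(_ m (leqnn m))] /=.
by rewrite sub0r normrN ltNge bound.
Qed.

Lemma power_series_zero (u : nat -> R) (r : R) : 0 < r ->
  (forall t, 0 < t < r -> (fun M : nat => \sum_(k < M) t ^+ k * u k) @ \oo --> (0 : R)) ->
  forall k, u k = 0.
Proof.
move=> r0 H k; elim: k u H => [|k IH] u H; first exact: power_series_zero_head H.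
apply: (IH (fun k => u k.+1)) => t tr.
have u0 : u 0%N = 0 by exact: power_series_zero_head H.
have t0 : t != 0 by case/andP: tr => t0 _; rewrite gt_eqF.
rewrite (_ : (fun M : nat => _) = (fun M : nat =>
    t^-1 * \sum_(k < M.+1) t ^+ k * u k)); last first.
  apply/funext => M; rewrite big_ord_recl u0 mulr0 add0r mulr_sumr.
  apply: eq_bigr => i _; rewrite lift0 exprS.
  by rewrite -(mulrA t) mulKf.
have := H _ tr; rewrite -cvg_shiftS => Ht.
have := cvgM (cvg_cst t^-1) Ht; rewrite mulr0; exact.
Qed.

Lemma zpow_series_zero (n : nat) (r : \bar R) (P Q : nat -> Cl R n.+1) : (0 < r)%E ->
  (forall a b, ((Num.sqrt (a ^+ 2 + b ^+ 2))%:E < r)%E ->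
    clsum_to (fun k => zpow 1 k a b (P k) + zpow (-1) k a b (Q k)) 0) ->
  P 0%N + Q 0%N = 0 /\ forall k, P k.+1 = 0 /\ Q k.+1 = 0.
Proof.
move=> r0 H.
have [d d0 dr] : exists2 d : R, 0 < d & (d%:E <= r)%E.
  by case: r r0 {H} => [r|_|//]; [exists r; rewrite ?lexx// -lte_fin|exists 1; rewrite ?leey].
have Z k a b : zpow 1 k a b (P k) + zpow (-1) k a b (Q k) = 0.
  apply/ffunP => S; rewrite [RHS]ffunE.
  pose N := Num.sqrt (a ^+ 2 + b ^+ 2).
  have N0 : 0 <= N by exact: sqrtr_ge0.
  apply: (@power_series_zero (fun k => (zpow 1 k a b (P k) + zpow (-1) k a b (Q k)) S)
    (d / (N + 1))) => [|t /andP[t0 td]]; first by rewrite divr_gt0// ltr_wpDl.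
  have := H (t * a) (t * b); rewrite !exprMn -mulrDr sqrtrM ?sqr_ge0// sqrtr_sqr.
  rewrite gtr0_norm// -/N => /(_ _)/wrap[|/(_ S)].
    apply: lt_le_trans dr; rewrite lte_fin.
    move: td; rewrite ltr_pdivlMr ?ltr_wpDl// mulrDr mulr1.
    by apply: le_lt_trans; rewrite lerDl ltW.
  rewrite ffunE; under eq_fun do under eq_bigr do rewrite !zpow_homo -clscaleDr ffunE.
  exact.
split; first by have := Z 0%N 1 0; rewrite !zpow_10.
move=> k.
have PQ : P k.+1 + Q k.+1 = 0 by have := Z k.+1 1 0; rewrite !zpow_10.
have D S : 0 = (clscale (1 * k.+1%:R) (zpow 1 k 1 0 (e1 R n ** P k.+1)) +
    clscale (-1 * k.+1%:R) (zpow (-1) k 1 0 (e1 R n ** Q k.+1))) S.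
  have D1 := is_derive_clD (is_derive_zpow_r 1 k.+1 1 0 (P k.+1))
    (is_derive_zpow_r (-1) k.+1 1 0 (Q k.+1)) S.
  rewrite -(@derive_val _ _ _ _ _ _ _ D1).
  under eq_fun do rewrite Z ffunE.
  by rewrite derive_cst.
have {}D : P k.+1 = Q k.+1.
  have : e1 R n ** P k.+1 = e1 R n ** Q k.+1.
    apply/ffunP => S; have := D S; rewrite !zpow_10 !ffunE => /esym/eqP.
    rewrite mul1r mulN1r mulNr subr_eq0 => /eqP; apply: mulfI.
    by rewrite pnatr_eq0.
  move=> /(congr1 (clmul (e1 R n))); rewrite !e1_mulK; exact: oppr_inj.
suff Q0 : Q k.+1 = 0 by rewrite D Q0.
by apply: cl_double_inj; rewrite addr0 -{1}D.
Qed.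

End PowerSeries.

Section CauchySeries.
Set Implicit Arguments.
Unset Strict Implicit.
Variables (R : realType) (n : nat) (U : set 'rV[R]_n) (A B : nat -> 'rV[R]_n -> Cl R n.+1).
Hypothesis openU : open U.
Hypothesis smoothA : forall k, smooth_on U (A k).
Hypothesis smoothB : forall k, smooth_on U (B k).
Hypothesis B0 : B 0%N = fun=> 0.
Implicit Types (y : 'rV[R]_n).
Local Notation i1 := (e1 R n).

Lemma termE k x0 x1 y :
  term A B k x0 x1 y = zpow 1 k x0 x1 (A k y) + zpow (-1) k x0 x1 (B k y).
Proof.
case: k => [|k]; first by rewrite !zpow0 B0 addr0.
by rewrite /term clpow_zzE clpow_zzbarE.
Qed.

Lemma pdX_term_x0 k x0 x1 y : pdX (Dx0 n) (term A B k) x0 x1 y =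
  clscale k%:R (zpow 1 k.-1 x0 x1 (A k y)) + clscale k%:R (zpow (-1) k.-1 x0 x1 (B k y)).
Proof.
apply/ffunP => S; rewrite [LHS]ffunE derive1E.
under eq_fun do rewrite termE.
have D := is_derive_clD (is_derive_zpow_l 1 k x0 x1 (A k y))
  (is_derive_zpow_l (-1) k x0 x1 (B k y)) S.
by rewrite (@derive_val _ _ _ _ _ _ _ D).
Qed.

Lemma pdX_term_x1 k x0 x1 y : pdX (Dx1 n) (term A B k) x0 x1 y =
  clscale k%:R (zpow 1 k.-1 x0 x1 (i1 ** A k y)) -
  clscale k%:R (zpow (-1) k.-1 x0 x1 (i1 ** B k y)).
Proof.
apply/ffunP => S; rewrite [LHS]ffunE derive1E.
under eq_fun do rewrite termE.
have D := is_derive_clD (is_derive_zpow_r 1 k x0 x1 (A k y))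
  (is_derive_zpow_r (-1) k x0 x1 (B k y)) S.
rewrite (@derive_val _ _ _ _ _ _ _ D) mul1r mulN1r.
by rewrite !ffunE mulNr.
Qed.

Lemma pdX_term_y k j x0 x1 y : U y -> pdX (Dy j) (term A B k) x0 x1 y =
  zpow 1 k x0 x1 (pdy j (A k) y) + zpow (-1) k x0 x1 (pdy j (B k) y).
Proof.
move=> Uy; rewrite -[LHS]/(pdy j (term A B k x0 x1) y).
rewrite (_ : term A B k x0 x1 =
  fun q => zpow 1 k x0 x1 (A k q) + zpow (-1) k x0 x1 (B k q)); last first.
  by apply/funext => q; rewrite termE.
apply: is_pdy_val; apply: is_pdyD; apply: is_pdy_linear.
- exact: cl_linear_zpow.
- exact/is_pdyP/(smooth_pdyable (smoothA k)).
- exact: cl_linear_zpow.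
- exact/is_pdyP/(smooth_pdyable (smoothB k)).
Qed.

Lemma sum_ey_pdX_term k x0 x1 y : U y ->
  \sum_j ey R j ** pdX (Dy j) (term A B k) x0 x1 y =
  zpow (-1) k x0 x1 (diracL (A k) y) + zpow 1 k x0 x1 (diracL (B k) y).
Proof.
move=> Uy; rewrite /diracL !(cl_linear_sum _ _ _ (cl_linear_zpow _ _ _ _)) -big_split.
apply: eq_bigr => j _; rewrite pdX_term_y// clmulDr !ey_zpow opprK.
by [].
Qed.

Lemma sum_pdX_term_ey k x0 x1 y : U y ->
  \sum_j pdX (Dy j) (term A B k) x0 x1 y ** ey R j =
  zpow 1 k x0 x1 (diracR (A k) y) + zpow (-1) k x0 x1 (diracR (B k) y).
Proof.
move=> Uy; rewrite /diracR !(cl_linear_sum _ _ _ (cl_linear_zpow _ _ _ _)) -big_split.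
by apply: eq_bigr => j _; rewrite pdX_term_y// clmulDl !zpow_mulr.
Qed.

Lemma cauchyL_series (Om : R -> R -> 'rV[R]_n -> Prop) F x0 x1 y :
  series_ok Om (term A B) F -> Om x0 x1 y -> U y ->
  clsum_to (fun k => zpow 1 k x0 x1 (diracL (B k) y) +
      zpow (-1) k x0 x1 (clscale (2 * k.+1%:R) (B k.+1 y) + diracL (A k) y))
    (cauchyL F x0 x1 y).
Proof.
move=> ok Omxy Uy; have [_ okd] := ok _ _ _ Omxy.
have S0 := (okd (Dx0 n)).2.2; have S1 := (okd (Dx1 n)).2.2.
have Sy j := (okd (Dy j)).2.2.
have H01 : clsum_to (fun k => clscale (2 * k%:R) (zpow (-1) k.-1 x0 x1 (B k y)))
    (pdX (Dx0 n) F x0 x1 y + i1 ** pdX (Dx1 n) F x0 x1 y).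
  apply: clsum_to_eq (clsum_toD S0 (clsum_to_linear (cl_linear_mull i1) S1)) => k.
  rewrite pdX_term_x0 pdX_term_x1 clmulDr clmulNr !clmulZr -!zpow_e1 !e1_mulK.
  by rewrite -!clscaleN1 !(cl_linearZ _ _ (cl_linear_zpow _ _ _ _));
    apply/ffunP => S; rewrite !ffunE; ring.
have Hy := clsum_to_sum (fun j => clsum_to_linear (cl_linear_mull (ey R j)) (Sy j)).
have := clsum_toD (clsum_to_shift _ H01) Hy; rewrite mulr0 clscale0 => /(_ erefl).
apply: clsum_to_eq => k /=; rewrite sum_ey_pdX_term//.
rewrite (cl_linearD _ _ (cl_linear_zpow _ _ _ _)) (cl_linearZ _ _ (cl_linear_zpow _ _ _ _)).
by rewrite addrA addrC.
Qed.

Lemma cauchyR_series (Om : R -> R -> 'rV[R]_n -> Prop) F x0 x1 y :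
  series_ok Om (term A B) F -> Om x0 x1 y -> U y ->
  clsum_to (fun k =>
      zpow 1 k x0 x1 (clscale k.+1%:R (A k.+1 y + conj1 (A k.+1 y)) + diracR (A k) y) +
      zpow (-1) k x0 x1 (clscale k.+1%:R (B k.+1 y - conj1 (B k.+1 y)) + diracR (B k) y))
    (cauchyR F x0 x1 y).
Proof.
move=> ok Omxy Uy; have [_ okd] := ok _ _ _ Omxy.
have S0 := (okd (Dx0 n)).2.2; have S1 := (okd (Dx1 n)).2.2.
have Sy j := (okd (Dy j)).2.2.
have H01 : clsum_to (fun k =>
    clscale k%:R (zpow 1 k.-1 x0 x1 (A k y + conj1 (A k y))) +
    clscale k%:R (zpow (-1) k.-1 x0 x1 (B k y - conj1 (B k y))))
    (pdX (Dx0 n) F x0 x1 y + pdX (Dx1 n) F x0 x1 y ** i1).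
  apply: clsum_to_eq (clsum_toD S0 (clsum_to_linear (cl_linear_mulr i1) S1)) => k.
  rewrite pdX_term_x0 pdX_term_x1 clmulDl clmulNl !clmulZl -!zpow_mulr /conj1.
  rewrite -(clscaleN1 (i1 ** B k y ** i1)) !(cl_linearD _ _ (cl_linear_zpow _ _ _ _)).
  rewrite (cl_linearZ _ _ (cl_linear_zpow _ _ _ _)).
  by apply/ffunP => S; rewrite !ffunE; ring.
have Hy := clsum_to_sum (fun j => clsum_to_linear (cl_linear_mulr (ey R j)) (Sy j)).
have := clsum_toD (clsum_to_shift _ H01) Hy; rewrite !clscale0 addr0 => /(_ erefl).
apply: clsum_to_eq => k /=; rewrite sum_pdX_term_ey//.
rewrite 2!(cl_linearD (clscale _ _) _ (cl_linear_zpow _ _ _ _)).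
by rewrite !(cl_linearZ _ _ (cl_linear_zpow _ _ _ _)) addrACA.
Qed.

Lemma two_sided_monogenic_coefs (r : \bar R) F : (0 < r)%E ->
  series_ok (Omega r U) (term A B) F ->
  two_sided_monogenic (Omega r U) F <->
  forall y, U y ->
    [/\ forall k, clscale (2 * k.+1%:R) (B k.+1 y) + diracL (A k) y = 0,
        forall k, diracL (B k) y = 0,
        clscale 1 (A 1%N y + conj1 (A 1%N y)) + diracR (A 0%N) y +
          clscale 1 (B 1%N y - conj1 (B 1%N y)) = 0,
        forall k, clscale k.+2%:R (A k.+2 y + conj1 (A k.+2 y)) + diracR (A k.+1) y = 0 &
        forall k, clscale k.+2%:R (B k.+2 y - conj1 (B k.+2 y)) + diracR (B k.+1) y = 0].
Proof.
move=> r0 ok; split=> [[mL mR] y Uy|H].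
  have hL : forall a b, ((Num.sqrt (a ^+ 2 + b ^+ 2))%:E < r)%E ->
      cauchyL F a b y = 0 by move=> a b abr; have [] := mL a b y (conj abr Uy).
  have hR : forall a b, ((Num.sqrt (a ^+ 2 + b ^+ 2))%:E < r)%E ->
      cauchyR F a b y = 0 by move=> a b abr; have [] := mR a b y (conj abr Uy).
  have [] := zpow_series_zero (P := fun k => diracL (B k) y)
    (Q := fun k => clscale (2 * k.+1%:R) (B k.+1 y) + diracL (A k) y) r0.
    by move=> a b abr; rewrite -(hL _ _ abr); exact: cauchyL_series ok (conj abr Uy) Uy.
  rewrite B0 diracL0 add0r => L0 LS.
  have [] := zpow_series_zero
    (P := fun k => clscale k.+1%:R (A k.+1 y + conj1 (A k.+1 y)) + diracR (A k) y)
    (Q := fun k => clscale k.+1%:R (B k.+1 y - conj1 (B k.+1 y)) + diracR (B k) y) r0.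
    by move=> a b abr; rewrite -(hR _ _ abr); exact: cauchyR_series ok (conj abr Uy) Uy.
  rewrite B0 diracR0 addr0 => R0 RS.
  split=> //.
  - by case=> [|k]; [exact: L0|have [] := LS k].
  - by case=> [|k]; [rewrite B0 diracL0|have [] := LS k].
  - by move=> k; have [] := RS k.
  - by move=> k; have [] := RS k.
have zz0 s k a b : zpow s k a b (0 : Cl R n.+1) = 0.
  exact: cl_linear0 (cl_linear_zpow _ _ _ _).
split=> a b y abU; have [abr Uy] := abU; have [H1 H2 H3 H4 H5] := H y Uy.
all: have [_ okd] := ok a b y abU; split; first by move=> d; have [] := okd d.
- apply: clsum_to_unique (cauchyL_series ok abU Uy) _.
  by apply: clsum_to_eq (@clsum_to0 R n.+1) => k; rewrite H1 H2 !zz0 addr0.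
- apply: clsum_to_unique (cauchyR_series ok abU Uy) _.
  apply: clsum_to_eq (@clsum_to0 R n.+1) => -[|k]; last by rewrite H4 H5 !zz0 addr0.
  by rewrite !zpow0 B0 diracR0 addr0 H3.
Qed.

End CauchySeries.

Section Characterization.
Set Implicit Arguments.
Unset Strict Implicit.
Variables (R : realType) (n : nat) (U : set 'rV[R]_n).
Hypothesis openU : open U.
Implicit Types (f M : 'rV[R]_n -> Cl R n.+1) (y : 'rV[R]_n).

Lemma harmonic_onP f : smooth_on U f ->
  harmonic_on U f <-> forall y, U y -> laplacian f y = 0.
Proof.
move=> sf; split=> [H y /H[]//|H y Uy]; split; last exact: H.
by move=> j; split; [exact: smooth_pdyable sf Uy|exact: smooth_pdyable (smooth_pdy j sf) Uy].
Qed.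

Lemma cl_linear_addconj1 : cl_linear (fun x : Cl R n.+1 => x + conj1 x).
Proof. by apply: cl_linear_add; [exact: cl_linear_id|exact: cl_linear_conj1]. Qed.

Lemma cl_linear_subconj1 : cl_linear (fun x : Cl R n.+1 => x - conj1 x).
Proof.
apply: cl_linear_add; first exact: cl_linear_id.
by apply: cl_linear_comp; [exact: cl_linear_opp|exact: cl_linear_conj1].
Qed.

Lemma diracL_addconj1 f y : smooth_on U f -> U y ->
  diracL (fun q => f q + conj1 (f q)) y = diracL f y - conj1 (diracL f y).
Proof.
apply: (@diracL_linear _ _ _ _ _ (fun x => x + conj1 x) (fun x => x - conj1 x)).
- exact: cl_linear_addconj1.
- exact: cl_linear_subconj1.
- by move=> j x; rewrite clmulDr ey_conj1.
Qed.

Lemma diracL_subconj1 f y : smooth_on U f -> U y ->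
  diracL (fun q => f q - conj1 (f q)) y = diracL f y + conj1 (diracL f y).
Proof.
apply: (@diracL_linear _ _ _ _ _ (fun x => x - conj1 x) (fun x => x + conj1 x)).
- exact: cl_linear_subconj1.
- exact: cl_linear_addconj1.
- by move=> j x; rewrite clmulDr clmulNr ey_conj1 opprK.
Qed.

Lemma diracR_subconj1 f y : smooth_on U f -> U y ->
  diracR (fun q => f q - conj1 (f q)) y = diracR f y + conj1 (diracR f y).
Proof.
apply: (@diracR_linear _ _ _ _ _ (fun x => x - conj1 x) (fun x => x + conj1 x)).
- exact: cl_linear_subconj1.
- exact: cl_linear_addconj1.
- by move=> j x; rewrite clmulDl clmulNl conj1_ey opprK.
Qed.

Variables (A B : nat -> 'rV[R]_n -> Cl R n.+1).
Hypothesis smoothA : forall k, smooth_on U (A k).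
Hypothesis smoothB : forall k, smooth_on U (B k).

Lemma clscale_eq_opp (c : R) (x z : Cl R n.+1) : c != 0 ->
  clscale c x + z = 0 <-> x = clscale (- (1 / c)) z.
Proof.
move=> c0; split=> [|->].
  move/eqP; rewrite addr_eq0 => /eqP /(congr1 (clscale c^-1)).
  rewrite clscaleA mulVf// clscale1 => ->.
  by apply/ffunP => S; rewrite !ffunE; field.
by apply/ffunP => S; rewrite !ffunE; field.
Qed.

Lemma coefs_characterization : B 0%N = (fun=> 0) ->
  (forall y, U y ->
    [/\ forall k, clscale (2 * k.+1%:R) (B k.+1 y) + diracL (A k) y = 0,
        forall k, diracL (B k) y = 0,
        clscale 1 (A 1%N y + conj1 (A 1%N y)) + diracR (A 0%N) y +
          clscale 1 (B 1%N y - conj1 (B 1%N y)) = 0,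
        forall k, clscale k.+2%:R (A k.+2 y + conj1 (A k.+2 y)) + diracR (A k.+1) y = 0 &
        forall k, clscale k.+2%:R (B k.+2 y - conj1 (B k.+2 y)) + diracR (B k.+1) y = 0])
  <->
  [/\ (forall k, harmonic_on U (A k)),
      (forall y, U y ->
         diracR (A 0%N) y + A 1%N y + conj1 (A 1%N y)
         - clscale (1 / 2) (diracL (A 0%N) y)
         + clscale (1 / 2) (conj1 (diracL (A 0%N) y)) = 0),
      (forall k y, (1 <= k)%N -> U y ->
         diracR (A k) y + clscale (k.+1)%:R (A k.+1 y)
         + clscale (k.+1)%:R (conj1 (A k.+1 y)) = 0) &
      (forall k y, U y ->
         B k.+1 y = clscale (- (1 / (2 * (k.+1)%:R))) (diracL (A k) y))].
Proof.
move=> B0.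
have k0 k : 2 * k.+1%:R != 0 :> R by rewrite mulf_neq0// pnatr_eq0.
have conjZ c (x : Cl R n.+1) : conj1 (clscale c x) = clscale c (conj1 x).
  by rewrite cl_linearZ//; exact: cl_linear_conj1.
have head y : B 1%N y = clscale (- (1 / (2 * 1%:R))) (diracL (A 0%N) y) ->
  clscale 1 (A 1%N y + conj1 (A 1%N y)) + diracR (A 0%N) y +
    clscale 1 (B 1%N y - conj1 (B 1%N y)) =
  diracR (A 0%N) y + A 1%N y + conj1 (A 1%N y)
    - clscale (1 / 2) (diracL (A 0%N) y)
    + clscale (1 / 2) (conj1 (diracL (A 0%N) y)).
  by move=> ->; rewrite conjZ; apply/ffunP => S; rewrite !ffunE; field.
have sdA k := smooth_diracL openU (smoothA k).
split=> [H|[hA H0 Hk HB] y Uy].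
  have HB k y : U y -> B k.+1 y = clscale (- (1 / (2 * (k.+1)%:R))) (diracL (A k) y).
    by move=> /H[H1 _ _ _ _]; apply/clscale_eq_opp.
  split=> //.
  - move=> k; apply/harmonic_onP => // y Uy.
    apply: oppr_inj; rewrite -(diracL_sqr openU (smoothA k) Uy) oppr0.
    rewrite (@diracL_near _ _ U (fun q => clscale (- (2 * k.+1%:R)) (B k.+1 q)))//.
    + by rewrite (diracLZ _ (smoothB k.+1) Uy); have [_ -> _ _ _] := H y Uy; rewrite clscaler0.
    + exact: (smooth_linear openU (@cl_linear_scale _ _ _) (smoothB _)).
    + move=> q /H[/(_ k) H1 _ _ _ _]; apply/eqP; rewrite -subr_eq0 -oppr_eq0 -H1.
      by apply/eqP/ffunP => S; rewrite !ffunE; ring.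
  - by move=> y Uy; rewrite -head; [have [] := H y Uy|exact: HB].
  - case=> // k y _ Uy; have [_ _ _ /(_ k) <- _] := H y Uy.
    by apply/ffunP => S; rewrite !ffunE; ring.
have lapA k : diracL (diracL (A k)) y = 0.
  by rewrite (diracL_sqr openU)//; have [_ ->] := hA k y Uy; rewrite oppr0.
have dRA k : diracL (diracR (A k)) y =
    clscale (- k.+1%:R) (diracL (A k.+1) y - conj1 (diracL (A k.+1) y)).
  have sS : smooth_on U (fun q => A k.+1 q + conj1 (A k.+1 q)).
    exact: (smooth_linear openU cl_linear_addconj1 (smoothA _)).
  have sZ c : smooth_on U (fun q => clscale c (A k.+1 q + conj1 (A k.+1 q))).
    exact: (smooth_linear openU (@cl_linear_scale _ _ c) sS).
  rewrite -diracL_addconj1// -(diracLZ _ sS Uy); case: k sS sZ => [|k] sS sZ.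
    have sD : smooth_on U (fun q => diracL (A 0%N) q - conj1 (diracL (A 0%N) q)).
      exact: (smooth_linear openU cl_linear_subconj1 (sdA _)).
    have sD2 : smooth_on U
        (fun q => clscale (1 / 2) (diracL (A 0%N) q - conj1 (diracL (A 0%N) q))).
      exact: (smooth_linear openU (@cl_linear_scale _ _ _) sD).
    rewrite (@diracL_near _ _ U (fun q =>
      clscale (- 1%:R) (A 1%N q + conj1 (A 1%N q)) +
      clscale (1 / 2) (diracL (A 0%N) q - conj1 (diracL (A 0%N) q))))//.
    + rewrite (diracLD (sZ _) sD2 Uy) (diracLZ _ sD Uy) (diracL_subconj1 (sdA _) Uy).
      by rewrite lapA -[conj1 0]/(conj1 0) (cl_linear0 (@cl_linear_conj1 _ _)) addr0
         clscaler0 addr0.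
    + exact: smoothD.
    + move=> q /H0 E; apply/eqP; rewrite -subr_eq0 -oppr_eq0 -E.
      by apply/eqP/ffunP => S; rewrite !ffunE; field.
  apply: (diracL_near openU (sZ _) Uy) => q Uq.
  apply/eqP; rewrite -subr_eq0 -oppr_eq0 -(Hk k.+1 q isT Uq).
  by apply/eqP/ffunP => S; rewrite !ffunE; ring.
have sB k c : smooth_on U (fun q => clscale c (diracL (A k) q)).
  exact: (smooth_linear openU (@cl_linear_scale _ _ _) (sdA _)).
split.
- by move=> k; apply/clscale_eq_opp => //; exact: HB.
- case=> [|k]; first by rewrite B0 diracL0.
  rewrite (diracL_near openU (sB k _) Uy (fun q Uq => esym (HB k q Uq))).
  by rewrite (diracLZ _ (sdA k) Uy) lapA clscaler0.
- by rewrite head; [exact: H0|exact: HB].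
- by move=> k; rewrite -(Hk k.+1 y isT Uy); apply/ffunP => S; rewrite !ffunE; ring.
- move=> k; rewrite (diracR_near openU (sB k _) Uy (fun q Uq => esym (HB k q Uq))).
  rewrite (diracRZ _ (sdA k) Uy) -(diracLR openU (smoothA k) Uy) dRA HB// conjZ.
  have k1 : k.+1%:R != 0 :> R by rewrite pnatr_eq0.
  have k2 : k.+2%:R != 0 :> R by rewrite pnatr_eq0.
  apply/ffunP => S; rewrite !ffunE.
  by move: (k.+1%:R : R) (k.+2%:R : R) k1 k2 => c d c0 d0; field; rewrite c0 d0.
Qed.

End Characterization.

Lemma conj1_series_monogenic (R : realType) (n : nat) (r : \bar R) (U : set 'rV[R]_n)
    (M B : nat -> 'rV[R]_n -> Cl R n.+1) (F : FunX R n) :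
  (0 < r)%E -> open U ->
  (forall k, right_monogenic_y U (M k)) -> (forall k, smooth_on U (M k)) ->
  B 0%N = (fun=> 0) ->
  (forall k, B k.+1 = fun y => clscale (- (1 / (2 * (k.+1)%:R)))
     (diracL (M k) y + conj1 (diracL (M k) y))) ->
  series_ok (Omega r U) (term (fun k y => M k y - conj1 (M k y)) B) F ->
  two_sided_monogenic (Omega r U) F.
Proof.
move=> r0 oU mM sM B0 BS ok.
have sA k : smooth_on U (fun y => M k y - conj1 (M k y)).
  exact: (smooth_linear oU (@cl_linear_subconj1 R n) (sM k)).
have sB k : smooth_on U (B k).
  case: k => [|k]; first by rewrite B0; exact: smooth0.
  have sD := smooth_diracL oU (sM k).
  rewrite BS; apply: (smooth_linear oU (@cl_linear_scale R n.+1 _)).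
  exact: (smooth_linear oU (@cl_linear_addconj1 R n) sD).
have c0 : conj1 (0 : Cl R n.+1) = 0 by exact: cl_linear0 (@cl_linear_conj1 R n).
have c1 (x x' : Cl R n.+1) : conj1 (x + x') = conj1 x + conj1 x'.
  exact: cl_linearD (@cl_linear_conj1 R n).
have c2 (x x' : Cl R n.+1) : conj1 (x - x') = conj1 x - conj1 x'.
  by rewrite c1 -(clscaleN1 x') (cl_linearZ _ _ (@cl_linear_conj1 R n)) clscaleN1.
have RA k y : U y -> diracR (fun q => M k q - conj1 (M k q)) y = 0.
  move=> Uy; rewrite (diracR_subconj1 (sM k) Uy).
  by have [_ ->] := mM k y Uy; rewrite c0 addr0.
apply/(two_sided_monogenic_coefs sA sB B0 r0 ok)/(coefs_characterization oU sA sB B0).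
split.
- move=> k; apply/(harmonic_onP (sA k)) => y Uy.
  apply: oppr_inj; rewrite -(diracR_sqr oU (sA k) Uy) oppr0.
  by rewrite (diracR_near oU (@smooth0 R n U) Uy (fun q Uq => esym (RA k q Uq))) diracR0.
- move=> y Uy; rewrite (RA _ _ Uy) (diracL_subconj1 (sM _) Uy) c2 c1 !conj1K.
  by apply/ffunP => S; rewrite !ffunE; ring.
- move=> k y _ Uy; rewrite (RA _ _ Uy) c2 conj1K.
  by apply/ffunP => S; rewrite !ffunE; ring.
- by move=> k y Uy; rewrite BS (diracL_subconj1 (sM _) Uy).
Qed.

Theorem theorem3 (R : realType) (n : nat) (r : \bar R) (U : set 'rV[R]_n) :
  (0 < r)%E -> open U ->
  (* Part 1: characterization *)
  (forall (A B : nat -> 'rV[R]_n -> Cl R n.+1) (F : FunX R n),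
     (forall k, smooth_on U (A k) /\ smooth_on U (B k)) ->
     series_ok (Omega r U) (term A B) F ->
     (two_sided_monogenic (Omega r U) F <->
      [/\ (forall k, harmonic_on U (A k)),
          (forall y, U y ->
             diracR (A 0%N) y + A 1%N y + clmul (clmul (e1 R n) (A 1%N y)) (e1 R n)
             - clscale (1 / 2) (diracL (A 0%N) y)
             + clscale (1 / 2) (clmul (clmul (e1 R n) (diracL (A 0%N) y)) (e1 R n)) = 0),
          (forall k y, (1 <= k)%N -> U y ->
             diracR (A k) y + clscale (k.+1)%:R (A k.+1 y)
             + clscale (k.+1)%:R (clmul (clmul (e1 R n) (A k.+1 y)) (e1 R n)) = 0) &
          (forall k y, U y ->
             B k.+1 y = clscale (- (1 / (2 * (k.+1)%:R))) (diracL (A k) y))])) /\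
  (* Part 2: the "in particular" (z^0 term read as M_0 - e1 M_0 e1, see NOTES.md) *)
  (forall (M : nat -> 'rV[R]_n -> Cl R n.+1) (F : FunX R n),
     (forall k, right_monogenic_y U (M k)) ->
     (forall k, smooth_on U (M k)) ->
     let A := fun k y => M k y - clmul (clmul (e1 R n) (M k y)) (e1 R n) in
     let B := fun k y => if k is k'.+1 then
                 clscale (- (1 / (2 * (k'.+1)%:R)))
                   (diracL (M k') y + clmul (clmul (e1 R n) (diracL (M k') y)) (e1 R n))
               else 0 in
     series_ok (Omega r U) (term A B) F ->
     two_sided_monogenic (Omega r U) F).
Proof.
move=> r0 oU; split=> [A B F sAB ok|M F mM sM A B ok]; last first.
  exact: (@conj1_series_monogenic R n r U M B F).
(* [B 0] does not occur in the series and is arbitrary; normalize it to [0]. *)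
pose B' k := if k is k'.+1 then B k else fun=> 0 : Cl R n.+1.
have sA k : smooth_on U (A k) by have [] := sAB k.
have sB k : smooth_on U (B' k).
  by case: k => [|k]; [exact: smooth0|have [] := sAB k.+1].
have tE : term A B = term A B' by apply/funext; case.
rewrite tE in ok.
split=> [/(two_sided_monogenic_coefs sA sB erefl r0 ok)|H].
  by move/(coefs_characterization oU sA sB erefl).
apply/(two_sided_monogenic_coefs sA sB erefl r0 ok).
exact/(coefs_characterization oU sA sB erefl).
Qed.
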